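(* Let $b$ be a connected graph over $(X,m)$ (with no killing term), let $(X_k)$ be an exhaustion, and let $t>0$. The following statements are equivalent: (i) The graph $b$ over $(X,m)$ is stochastically complete. (ii) $P^{(N)}_{t,k}\to P^{(D)}_t$ strongly in $\ell^1(X,m)$ as $k\to\infty$.
   Context: Graphs: $X$ is a countable discrete set and $m:X\to(0,\infty)$. A graph $b$ over $(X,m)$ (with killing term $c=0$) is a map $b:X\times X\to[0,\infty)$ with $b(x,y)=b(y,x)$, $b(x,x)=0$, $\sum_{y\in X}b(x,y)<\infty$ for all $x$. It is connected if any two vertices $x,y$ are joined by a path $x=x_0,\dots,x_n=y$ with $b(x_k,x_{k+1})>0$. $C_c(X)$ denotes the finitely supported functions; $\ell^p(X,m)$, $p\in[1,\infty)$, has norm $\|f\|_p=(\sum_x|f(x)|^pm(x))^{1/p}$, and $\ell^\infty(X)$ is the space of bounded functions. Dirichlet semigroup: let $\mathcal Q(f)=\frac12\sum_{x,y}b(x,y)(f(x)-f(y))^2$ for $f:X\to\mathbb R$ for which this is finite. $Q^{(D)}$ is the restriction of $\mathcal Q$ to the closure of $C_c(X)$ with respect to the norm $(\mathcal Q(f)+\|f\|_2^2)^{1/2}$; $L^{(D)}$ is the associated nonnegative self-adjoint operator on $\ell^2(X,m)$ and $P^{(D)}_t=e^{-tL^{(D)}}$. As $Q^{(D)}$ is a Dirichlet form, $P^{(D)}_t$ is positivity preserving and extends to a contraction semigroup on all $\ell^p(X,m)$, $p\in[1,\infty]$ (given by the same kernel $p_t(x,y)$, via $P_t^{(D)}f(x)=\sum_yp_t(x,y)f(y)m(y)$).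 The graph is stochastically complete if $P^{(D)}_t1=1$ for some (equivalently, all) $t>0$, where $1$ is the constant function. Exhaustions: an exhaustion is a sequence of finite sets $X_k\subseteq X$ with $X_k\subseteq X_{k+1}$ and $X=\bigcup_kX_k$, such that for each $k$ the graph obtained by restricting $b$ to $X_k\times X_k$ is connected. Neumann restrictions: for $f:X_k\to\mathbb R$ let $L^{(N)}_kf(x)=\frac1{m(x)}\sum_{y\in X_k}b(x,y)(f(x)-f(y))$ for $x\in X_k$, and $P^{(N)}_{t,k}=e^{-tL^{(N)}_k}$, regarded as an operator on functions on $X$ by first restricting to $X_k$, applying the operator, and then extending by $0$ to $X$. Strong convergence of operators means norm convergence when applied to each fixed function. *)

(* Defs.v *)
From HB Require Import structures.
From mathcomp Require Import all_boot all_order all_algebra finmap.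
From mathcomp Require Import all_classical all_reals all_analysis.
Set Implicit Arguments.
Unset Strict Implicit.
Unset Printing Implicit Defensive.
Import Order.TTheory GRing.Theory Num.Theory.
Import numFieldNormedType.Exports.
Local Open Scope classical_set_scope.
Local Open Scope ring_scope.

(* Sum of an absolutely summable real family (meaningless otherwise). *)
Definition rsum (R : realType) (I : choiceType) (a : I -> R) : R :=
  fine (\esum_(i in [set: I]) (Num.max (a i) 0)%:E) -
  fine (\esum_(i in [set: I]) (Num.max (- a i) 0)%:E).

Definition is_graph (R : realType) (X : countType) (b : X -> X -> R) : Prop :=
  [/\ forall x y, 0 <= b x y,
      forall x y, b x y = b y x,
      forall x, b x x = 0 &
      forall x, (\esum_(y in [set: X]) (b x y)%:E < +oo)%E].

Definition graph_connected (R : realType) (V : eqType) (b : V -> V -> R)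
    : Prop :=
  forall x y, exists s : seq V,
    path (fun u v => 0 < b u v) x s /\ last x s = y.

Definition restrict_graph (R : realType) (X : countType) (b : X -> X -> R)
    (A : {fset X}) : A -> A -> R :=
  fun x y => b (val x) (val y).

Definition exhaustion (R : realType) (X : countType) (b : X -> X -> R)
    (Xk : nat -> {fset X}) : Prop :=
  [/\ forall k, (Xk k `<=` Xk k.+1)%fset,
      forall x, exists k, x \in Xk k &
      forall k, graph_connected (restrict_graph b (A := Xk k))].

Section Spaces.
Context (R : realType) (X : countType) (m : X -> R).

Definition l1norm (f : X -> R) : \bar R :=
  \esum_(x in [set: X]) (`|f x| * m x)%:E.

Definition l2norm_sq (f : X -> R) : \bar R :=
  \esum_(x in [set: X]) (`|f x| ^+ 2 * m x)%:E.

Definition in_l1 (f : X -> R) : Prop := (l1norm f < +oo)%E.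

Definition in_l2 (f : X -> R) : Prop := (l2norm_sq f < +oo)%E.

Definition l2inner (f g : X -> R) : R := rsum (fun x => f x * g x * m x).

Definition finitely_supported (f : X -> R) : Prop :=
  finite_set [set x | f x != 0].

End Spaces.

Section DirichletForm.
Context (R : realType) (X : countType) (b : X -> X -> R) (m : X -> R).

Definition energy (f : X -> R) : \bar R :=
  ((2^-1)%:E * \esum_(z in [set: X * X])
                 (b z.1 z.2 * (f z.1 - f z.2) ^+ 2)%:E)%E.

(* The symmetric bilinear form obtained from [energy] by polarization. *)
Definition energy_form (f g : X -> R) : R :=
  2^-1 * rsum (fun z : X * X =>
                 b z.1 z.2 * (f z.1 - f z.2) * (g z.1 - g z.2)).

Definition form_norm_sq (f : X -> R) : \bar R :=
  (energy f + l2norm_sq m f)%E.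

(* Domain of Q^(D): closure of the finitely supported functions in the space
   of all f with finite form norm. *)
Definition dirichlet_domain (f : X -> R) : Prop :=
  (form_norm_sq f < +oo)%E /\
  forall e : R, 0 < e -> exists phi : X -> R,
    finitely_supported phi /\ (form_norm_sq (f - phi)%R < (e ^+ 2)%:E)%E.

(* Graph of the unbounded operator associated with Q^(D): u lies in the domain
   of L^(D) and L^(D) u = f. *)
Definition dirichlet_laplacian (u f : X -> R) : Prop :=
  [/\ dirichlet_domain u, in_l2 m f &
      forall v, dirichlet_domain v -> energy_form u v = l2inner m f v].

End DirichletForm.

Section Semigroups.
Context (R : realType) (X : countType) (m : X -> R).

Definition bounded_l2_operator (T : (X -> R) -> (X -> R)) : Prop :=
  [/\ forall f, in_l2 m f -> in_l2 m (T f),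
      forall (a : R) f g, in_l2 m f -> in_l2 m g ->
        T (a *: f + g) = a *: T f + T g &
      exists C : R, forall f, in_l2 m f ->
        (l2norm_sq m (T f) <= C%:E * l2norm_sq m f)%E].

(* Strongly continuous semigroup on l^2(X,m); only the values [P t f] with
   t >= 0 and f in l^2 are constrained. *)
Definition C0_semigroup (P : R -> (X -> R) -> (X -> R)) : Prop :=
  [/\ forall t, 0 <= t -> bounded_l2_operator (P t),
      forall f, in_l2 m f -> P 0 f = f,
      forall s t f, 0 <= s -> 0 <= t -> in_l2 m f ->
        P (s + t) f = P s (P t f) &
      forall f, in_l2 m f -> l2norm_sq m (P t f - f) @[t --> 0^'+] --> 0%E].

Definition semigroup_generator (P : R -> (X -> R) -> (X -> R))
    (u g : X -> R) : Prop :=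
  [/\ in_l2 m u, in_l2 m g &
      l2norm_sq m (t^-1 *: (P t u - u) - g) @[t --> 0^'+] --> 0%E].

(* P t = exp (- t L) for t >= 0, where L is an unbounded operator on l^2 given
   by its graph: P is the semigroup with generator - L.  A strongly continuous
   semigroup is determined on l^2 by its generator. *)
Definition is_exp_semigroup (L : (X -> R) -> (X -> R) -> Prop)
    (P : R -> (X -> R) -> (X -> R)) : Prop :=
  C0_semigroup P /\ forall u f, semigroup_generator P u (- f) <-> L u f.

End Semigroups.

Section HeatSemigroups.
Context (R : realType) (X : countType) (b : X -> X -> R) (m : X -> R).

(* The default value 0 of [xget] plays no role: L^(D) is nonnegative and
   self-adjoint, hence - L^(D) generates a semigroup. *)
Definition dirichlet_semigroup_l2 : R -> (X -> R) -> (X -> R) :=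
  xget (fun _ _ => 0)
    [set P | is_exp_semigroup m (dirichlet_laplacian b m) P].

Definition heat_kernel (t : R) (x y : X) : R :=
  dirichlet_semigroup_l2 t (fun z => (z == y)%:R) x / m y.

(* Extension of the semigroup from l^2 to all l^p spaces. *)
Definition dirichlet_semigroup (t : R) (f : X -> R) : X -> R :=
  fun x => rsum (fun y => heat_kernel t x y * f y * m y).

Definition stochastically_complete : Prop :=
  exists2 t : R, 0 < t & dirichlet_semigroup t (fun _ => 1) = (fun _ => 1).

Definition neumann_laplacian (A : {fset X}) (f : A -> R) : A -> R :=
  fun x => (m (val x))^-1 *
    \sum_(y : A) b (val x) (val y) * (f x - f y).

(* Exponential series of a linear operator on a finite-dimensional space of
   functions, where operator norm convergence is pointwise convergence. *)
Definition exp_operator (V : finType) (T : (V -> R) -> (V -> R))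
    (f : V -> R) : V -> R :=
  fun x => limn (series (fun n => (n`!%:R)^-1 * iter n T f x)).

Definition extend_by_0 (A : {fset X}) (f : A -> R) : X -> R :=
  fun x => if insub x is Some y then f y else 0.

Definition neumann_semigroup (A : {fset X}) (t : R) (f : X -> R) : X -> R :=
  extend_by_0
    (exp_operator (fun g => - t *: neumann_laplacian g)
                  (fun x : A => f (val x))).

End HeatSemigroups.

Definition strong_l1_cvg (R : realType) (X : countType) (m : X -> R)
    (T_ : nat -> (X -> R) -> (X -> R)) (T : (X -> R) -> (X -> R)) : Prop :=
  forall f, in_l1 m f -> l1norm m (T_ k f - T f) @[k --> \oo] --> 0%E.

(* Main.v *)
Require Import Defs.
From mathcomp Require Import all_boot all_order all_algebra finmap.
From mathcomp Require Import all_classical all_reals all_analysis.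
From mathcomp Require Import ring lra zify.
Import Order.TTheory GRing.Theory Num.Theory.
Import numFieldNormedType.Exports.
Set Implicit Arguments.
Unset Strict Implicit.
Unset Printing Implicit Defensive.
Local Open Scope classical_set_scope.
Local Open Scope ring_scope.

(** Write [D^k_t(x,y)] and [N^k_t(x,y)] for the kernels of the exponentials of
the Dirichlet and the Neumann restriction to [X_k], extended by 0 to [X].  The
two generators differ only on the diagonal, where the Dirichlet one also counts
the edges leaving [X_k]; so [0 <= D^k <= N^k].  Both kernels are symmetric with
respect to [m], the rows of [N^k] over [X_k] have sum 1, and [D^k] increases
with [k] to a kernel [S], the minimal heat kernel.  Hence
<<
   sum_x m(x) |N^k_t(x,y) - S_t(x,y)|
     <= sum_x m(x) (N^k_t - D^k_t)(x,y) + sum_x m(x) (S_t - D^k_t)(x,y)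
     <= 2 m(y) (1 - sum_x D^k_t(y,x)).
>>
If the rows of [S_t] have sum 1, the right hand side tends to 0 while it is
bounded by [2 m(y)], and dominated convergence in [y] gives strong convergence
in l1 ([conservative_strong_l1]).  Conversely, [N^k_t] sends the indicator of
[y] to a function of mass [m(y)] as soon as [y] lies in [X_k], and mass passes
to limits in l1, so that column [y] of [S_t] has mass [m(y)]; by symmetry, row
[y] of [S_t] has sum 1 ([strong_l1_mass]).  The semigroup law of [S] makes the
row sums decrease with time and carries the value 1 from one time to all
others ([conservative_all]).

It remains to see that [S_t] is the kernel of the Dirichlet semigroup, which is
specified through its generator: let [P] be any strongly continuous semigroup
generated by [- L^(D)].  The function [S_t(.,y)] is a limit of solutions of the
heat equation, but its membership in the domain of [L^(D)] is not visible at
[t = 0], where the indicator of [y] need not belong to that domain.  Its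
integral [W_t(.,y)] over the times in [[0,t]] behaves better: it belongs to the
domain, with [L^(D) W_t(.,y) = 1_y - S_t(.,y)] ([minker_int_laplacian]), and it
is differentiable in l2 as a function of [t], with derivative [S_t(.,y)]
([minker_int_sqlip]).  Consequently [u(s) = W_{s+h}(.,y) - W_s(.,y)] solves
[u' = - L^(D) u] in l2, and such a solution is [P_s u(0)] ([C0_unique]).  Thus
[P_t W_h(.,y) = W_{t+h}(.,y) - W_t(.,y)], and division by [h -> 0] yields
[P_t 1_y = S_t(.,y)] ([exp_semigroup_delta]).

The domain statement holds because [W_t] is the limit of the integrals [W^k_t]
of [D^k], which have finite support.  By Green's formula, the energy of
[W^k_t(.,y) - W^j_t(.,y)] is bounded by the increment between [j] and [k] of a
bounded monotone sequence, so these functions form a Cauchy sequence for the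
form norm.

The Dirichlet semigroup is a choice among the semigroups generated by
[- L^(D)], with default value 0.  For this default value each side of the
equivalence forces [X] to be empty, and then both sides hold. *)

(** * Sums over countable sets *)

Section Sums.
Context (R : realType) (I : choiceType).
Implicit Types (a p q f g w : I -> R) (F : {fset I}) (c : R).

(** Sums over infinite sets are bounded, and limits exchanged with them, through
their finite partial sums. *)
Lemma esum_leP a c :
  (\esum_(i in [set: I]) (a i)%:E <= c%:E)%E <->
  forall F, \sum_(i <- F) a i <= c.
Proof.
split=> [h F|h].
  rewrite -lee_fin (le_trans _ h)// esum_ge//; exists [set` F].
    by split => //; exact: finite_fset.
  by rewrite fsbig_finite ?finite_fset//= set_fsetK sumEFin.
apply: ge_ereal_sup => _ [A [finA _] <-].
by rewrite fsbig_finite//= sumEFin lee_fin.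
Qed.

Lemma sum_le_esum a F :
  ((\sum_(i <- F) a i)%:E <= \esum_(i in [set: I]) (a i)%:E)%E.
Proof.
rewrite esum_ge//; exists [set` F]; first by split => //; exact: finite_fset.
by rewrite fsbig_finite ?finite_fset//= set_fsetK sumEFin.
Qed.

Lemma sum_fset_supp a F G : (forall i, i \notin F -> a i = 0) ->
  (F `<=` G)%fset -> \sum_(i <- G) a i = \sum_(i <- F) a i.
Proof. by move=> aF FG; rewrite [RHS](big_fset_incl _ FG)// => i _ /aF. Qed.

Lemma sum_fset_le a F G : (forall i, 0 <= a i) -> (F `<=` G)%fset ->
  \sum_(i <- F) a i <= \sum_(i <- G) a i.
Proof.
move=> a0 FG; pose a' i := if i \in F then a i else 0.
have -> : \sum_(i <- F) a i = \sum_(i <- F) a' i.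
  by apply: eq_big_seq => i iF; rewrite /a' iF.
rewrite -(@sum_fset_supp a' F G)//; last by move=> i /negPf; rewrite /a' => ->.
by apply: ler_sum => i _; rewrite /a'; case: ifP.
Qed.

Lemma esum_finsupp a F : (forall i, 0 <= a i) ->
  (forall i, i \notin F -> a i = 0) ->
  \esum_(i in [set: I]) (a i)%:E = (\sum_(i <- F) a i)%:E.
Proof.
move=> a0 aF; apply/eqP; rewrite eq_le sum_le_esum andbT.
apply/esum_leP => G; rewrite -(sum_fset_supp aF (fsubsetUl F G)).
exact: sum_fset_le (fsubsetUr F G).
Qed.

Lemma esumZl a c : 0 <= c -> (forall i, 0 <= a i) ->
  \esum_(i in [set: I]) (c * a i)%:E
    = (c%:E * \esum_(i in [set: I]) (a i)%:E)%E.
Proof.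
have le_c b c' : 0 < c' ->
    (\esum_(i in [set: I]) (c' * b i)%:E
       <= c'%:E * \esum_(i in [set: I]) (b i)%:E)%E.
  move=> c0; apply: ge_ereal_sup => _ [A [finA _] <-].
  rewrite fsbig_finite//= sumEFin -mulr_sumr EFinM.
  by rewrite lee_wpmul2l ?lee_fin ?(ltW c0)// sum_le_esum.
rewrite le_eqVlt => /orP[/eqP <- a0|c0 a0].
  by rewrite mul0e esum1// => i _; rewrite mul0r.
apply/eqP; rewrite eq_le le_c//=.
have := le_c (fun i => c * a i) c^-1; rewrite invr_gt0 => /(_ c0) h.
have {h} : (\esum_(i in [set: I]) (a i)%:E <=
    (c^-1)%:E * \esum_(i in [set: I]) (c * a i)%:E)%E.
  by apply: le_trans h; apply: le_esum => i _; rewrite mulKf ?gt_eqF.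
move=> /(lee_wpmul2l (x := c%:E)); rewrite lee_fin => /(_ (ltW c0)).
by rewrite muleA -EFinM divff ?gt_eqF// mul1e.
Qed.

Lemma esumDE a b : (forall i, 0 <= a i) -> (forall i, 0 <= b i) ->
  \esum_(i in [set: I]) (a i + b i)%:E =
  (\esum_(i in [set: I]) (a i)%:E + \esum_(i in [set: I]) (b i)%:E)%E.
Proof. by move=> a0 b0; rewrite -esumD// => i _; rewrite lee_fin. Qed.

Lemma esum_fin a c : (\esum_(i in [set: I]) (a i)%:E <= c%:E)%E ->
  (forall i, 0 <= a i) ->
  \esum_(i in [set: I]) (a i)%:E = (fine (\esum_(i in [set: I]) (a i)%:E))%:E.
Proof.
move=> ac a0; rewrite fineK// ge0_fin_numE ?(le_lt_trans ac) ?ltry//.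
by apply: esum_ge0 => i _; rewrite lee_fin.
Qed.

(** Absolute summability is recorded through a real bound on finite partial
sums, so that it passes from one family to another by comparing finite sums. *)
Definition absum a : Prop :=
  exists c, forall F, \sum_(i <- F) `|a i| <= c.

Lemma absumP a : absum a <-> (\esum_(i in [set: I]) `|a i|%:E < +oo)%E.
Proof.
split=> [[c /esum_leP h]|h]; first by rewrite (le_lt_trans h)// ltry.
exists (fine (\esum_(i in [set: I]) `|a i|%:E)); apply/esum_leP.
by rewrite fineK// ge0_fin_numE// esum_ge0// => i _; rewrite lee_fin.
Qed.

Lemma absum_le a b : absum b -> (forall i, `|a i| <= b i) -> absum a.
Proof.
move=> [c h] ab; exists c => F; apply: le_trans (h F).
by apply: ler_sum => i _; rewrite (le_trans (ab i))// ler_norm.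
Qed.

Lemma absumD a b : absum a -> absum b -> absum (fun i => a i + b i).
Proof.
move=> [c h] [d k]; exists (c + d) => F.
rewrite (le_trans _ (lerD (h F) (k F)))// -big_split/=.
by apply: ler_sum => i _; exact: ler_normD.
Qed.

Lemma absumZ a k : absum a -> absum (fun i => k * a i).
Proof.
move=> [c h]; exists (`|k| * c) => F.
under eq_bigr do rewrite normrM.
by rewrite -mulr_sumr ler_wpM2l.
Qed.

Lemma absum_finsupp a F : (forall i, i \notin F -> a i = 0) -> absum a.
Proof.
move=> aF; exists (\sum_(i <- F) `|a i|); apply/esum_leP.
by rewrite (esum_finsupp (F := F))// => i /aF ->; rewrite normr0.
Qed.

(** The value of [rsum] does not depend on how the family is written as a
difference of two nonnegative summable families: for the positive and negative
parts [a^+, a^-] of [p - q], one has [a^+ + q = a^- + p]. Additivity of [rsum]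
follows. *)
Lemma rsum_diff p q : (forall i, 0 <= p i) -> (forall i, 0 <= q i) ->
  absum p -> absum q ->
  rsum (fun i => p i - q i) =
  fine (\esum_(i in [set: I]) (p i)%:E) - fine (\esum_(i in [set: I]) (q i)%:E).
Proof.
move=> p0 q0 Sp Sq; rewrite /rsum.
set a1 := fun i => Num.max (p i - q i) 0.
set a2 := fun i => Num.max (- (p i - q i)) 0.
have a1_ge0 i : 0 <= a1 i by rewrite /a1 le_max lexx orbT.
have a2_ge0 i : 0 <= a2 i by rewrite /a2 le_max lexx orbT.
have fin a : (forall i, 0 <= a i) -> absum a ->
    \esum_(i in [set: I]) (a i)%:E \is a fin_num.
  move=> a0 /absumP; rewrite ge0_fin_numE; last first.
    by apply: esum_ge0 => i _; rewrite lee_fin.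
  by under eq_esum do rewrite ger0_norm//.
have [f1 f2] : \esum_(i in [set: I]) (a1 i)%:E \is a fin_num /\
    \esum_(i in [set: I]) (a2 i)%:E \is a fin_num.
  split; apply: fin => //.
    apply: (absum_le (b := p)) => // i; rewrite ger0_norm// /a1.
    by rewrite ge_max p0 andbT gerBl.
  apply: (absum_le (b := q)) => // i; rewrite ger0_norm// /a2.
  by rewrite ge_max q0 andbT opprB gerBl.
apply/eqP; rewrite subr_eq addrAC eq_sym subr_eq -!fineD ?f1 ?f2 ?fin//.
apply/eqP; congr fine; rewrite -!esumD; try by move=> i _; rewrite lee_fin.
apply: eq_esum => i _; rewrite -!EFinD; congr EFin; rewrite /a1 /a2.
by case: (leP (p i - q i) 0); case: (leP (- (p i - q i)) 0); lra.
all: by move=> i _; rewrite lee_fin le_max lexx orbT.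
Qed.

Lemma absum_pos a : absum a -> absum (fun i => Num.max (a i) 0).
Proof.
move=> [c h]; apply: (@absum_le _ (fun i => `|a i|)).
  by exists c => F; under eq_bigr do rewrite normr_id; exact: h.
by move=> i; case: (leP 0 (a i)) => // _; rewrite normr0.
Qed.

Lemma absumN a : absum a -> absum (fun i => - a i).
Proof. by move=> [c h]; exists c => F; under eq_bigr do rewrite normrN. Qed.

Lemma absumB a b : absum a -> absum b -> absum (fun i => a i - b i).
Proof. by move=> ha hb; apply: absumD => //; exact: absumN. Qed.

Let pos a i : R := Num.max (a i) 0.
Let neg a i : R := Num.max (- a i) 0.

Let posB a i : pos a i - neg a i = a i.
Proof. by rewrite /pos /neg; case: (leP (a i) 0); case: (leP (- a i) 0); lra.
  Qed.

Let pos_ge0 a i : 0 <= pos a i. Proof. by rewrite le_max lexx orbT. Qed.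
Let neg_ge0 a i : 0 <= neg a i. Proof. by rewrite le_max lexx orbT. Qed.

Let fin_pos a : absum a -> (forall i, 0 <= a i) ->
  \esum_(i in [set: I]) (a i)%:E \is a fin_num.
Proof.
move=> /absumP ha a0; rewrite ge0_fin_numE.
  by under eq_esum do rewrite -(ger0_norm (a0 _)).
by apply: esum_ge0 => i _; rewrite lee_fin.
Qed.

Lemma eq_rsum a b : a =1 b -> rsum a = rsum b.
Proof. by move=> /funext ->. Qed.

Lemma rsumD a b : absum a -> absum b ->
  rsum (fun i => a i + b i) = rsum a + rsum b.
Proof.
move=> ha hb.
have [sa sb] := (absum_pos ha, absum_pos hb).
have [sa' sb'] := (absum_pos (absumN ha), absum_pos (absumN hb)).
rewrite (@eq_rsum _ (fun i => (pos a i + pos b i) - (neg a i + neg b i))).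
  rewrite rsum_diff; try exact: absumD; try by move=> i; rewrite addr_ge0.
  rewrite !esumDE ?pos_ge0 ?neg_ge0//.
  by rewrite !fineD ?fin_pos// /rsum; lra.
by move=> i; rewrite -[in LHS](posB a) -[in LHS](posB b); lra.
Qed.

Lemma rsum_ge0 a : (forall i, 0 <= a i) ->
  rsum a = fine (\esum_(i in [set: I]) (a i)%:E).
Proof.
move=> a0; rewrite /rsum [X in _ - fine X]esum1 ?subr0/=.
  by congr fine; apply: eq_esum => i _; rewrite max_l.
by move=> i _; rewrite max_r// oppr_le0.
Qed.

Lemma rsumN a : rsum (fun i => - a i) = - rsum a.
Proof.
by rewrite /rsum opprB; congr (_ - fine _); apply: eq_esum => i _;
   rewrite opprK.
Qed.

Lemma rsumZ a k : absum a -> rsum (fun i => k * a i) = k * rsum a.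
Proof.
wlog k0 : k / 0 <= k => [hw|] ha.
  have [/hw->//|k0] := leP 0 k; rewrite -[LHS]opprK -rsumN.
  rewrite -[k in RHS]opprK mulNr -hw ?oppr_ge0 ?ltW//.
  by congr (- rsum _); apply/funext => i; rewrite mulNr.
rewrite (@eq_rsum _ (fun i => k * pos a i - k * neg a i)).
  have [sa sa'] := (absum_pos ha, absum_pos (absumN ha)).
  rewrite rsum_diff; try exact: absumZ; try by move=> i; rewrite mulr_ge0.
  by rewrite !esumZl// !fineM ?fin_pos//= -mulrBr.
by move=> i; rewrite -mulrBr posB.
Qed.

Lemma rsumB a b : absum a -> absum b ->
  rsum (fun i => a i - b i) = rsum a - rsum b.
Proof. by move=> ha hb; rewrite rsumD ?rsumN//; exact: absumN. Qed.

Lemma rsum_le a c : (forall F, \sum_(i <- F) `|a i| <= c) -> `|rsum a| <= c.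
Proof.
move=> h; have ha : absum a by exists c.
have [sa sa'] := (absum_pos ha, absum_pos (absumN ha)).
have : (\esum_(i in [set: I]) (pos a i)%:E +
        \esum_(i in [set: I]) (neg a i)%:E <= c%:E)%E.
  rewrite -esumDE//; apply/esum_leP => F; apply: le_trans (h F);
    apply: ler_sum => i _.
  rewrite /pos /neg; case: (ger0P (a i)); case: (leP (a i) 0);
  by case: (leP (- a i) 0); lra.
have := @fin_pos _ sa (@pos_ge0 a); have := @fin_pos _ sa' (@neg_ge0 a).
have : (0 <= \esum_(i in [set: I]) (pos a i)%:E)%E.
  by apply: esum_ge0 => i _; rewrite lee_fin.
have : (0 <= \esum_(i in [set: I]) (neg a i)%:E)%E.
  by apply: esum_ge0 => i _; rewrite lee_fin.
rewrite /rsum -/(pos a) -/(neg a).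
case: (esum _ (fun i => (pos a i)%:E)) => [p| |]//.
case: (esum _ (fun i => (neg a i)%:E)) => [n| |]//=.
rewrite -EFinD !lee_fin => n0 p0 _ _ pn; rewrite ler_norml.
by apply/andP; split; lra.
Qed.

Lemma rsum_finsupp a F : (forall i, i \notin F -> a i = 0) ->
  rsum a = \sum_(i <- F) a i.
Proof.
move=> aF; rewrite /rsum !(esum_finsupp (F := F))//=.
  by rewrite -sumrB; apply: eq_bigr => i _; exact: posB.
- by move=> i; exact: neg_ge0.
- by move=> i /aF ->; rewrite oppr0 maxxx.
- by move=> i; exact: pos_ge0.
- by move=> i /aF ->; rewrite maxxx.
Qed.

Lemma rsum_sum (J : Type) (r : seq J) (a : J -> I -> R) :
  (forall j, absum (a j)) ->
  absum (fun i => \sum_(j <- r) a j i) /\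
  rsum (fun i => \sum_(j <- r) a j i) = \sum_(j <- r) rsum (a j).
Proof.
move=> ha; elim: r => [|j r [IH1 IH2]].
  under eq_fun do rewrite big_nil.
  rewrite big_nil (@rsum_finsupp _ fset0)// big_seq_fset0.
  by split => //; exact: (@absum_finsupp _ fset0).
under eq_fun do rewrite big_cons.
by rewrite big_cons rsumD ?IH2//; split => //; exact: absumD.
Qed.
End Sums.

Section Limits.
Context (R : realType).

Lemma cvg_bigsum (J : Type) (r : seq J) (P : pred J) (f : J -> nat -> R)
    (l : J -> R) :
  (forall j, P j -> f j k @[k --> \oo] --> l j) ->
  \sum_(j <- r | P j) f j k @[k --> \oo] --> \sum_(j <- r | P j) l j.
Proof.
move=> fl; elim: r => [|j r IH].
  by rewrite big_nil; under eq_fun do rewrite big_nil; exact: cvg_cst.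
rewrite big_cons; under eq_fun do rewrite big_cons.
by case: ifPn => // Pj; apply: cvgD => //; exact: fl.
Qed.

Lemma cvg_le (u : nat -> R) (l c : R) : u k @[k --> \oo] --> l ->
  (\forall k \near \oo, u k <= c) -> l <= c.
Proof. by move=> ul uc; exact: (ler_cvg_to ul (cvg_cst c) uc). Qed.

Context (I : choiceType).

(** Dominated convergence for sums: up to [e / 2], the dominating family lives
on a finite set. *)
Lemma tannery (g : nat -> I -> R) (h : I -> R) : absum h ->
  (forall k i, 0 <= g k i) -> (forall k i, g k i <= h i) ->
  (forall i, g k i @[k --> \oo] --> 0) ->
  forall e, 0 < e ->
  \forall k \near \oo, (\esum_(i in [set: I]) (g k i)%:E <= e%:E)%E.
Proof.
move=> hs g0 gh gl e e0.
have h0 i : 0 <= h i by rewrite (le_trans (g0 0%N i)).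
have [H HE] : exists H : R, \esum_(i in [set: I]) (h i)%:E = H%:E.
  exists (fine (\esum_(i in [set: I]) (h i)%:E)); have [M hM] := hs.
  apply: (@esum_fin _ _ _ M) => //; apply/esum_leP => F.
  by apply: le_trans (hM F); apply: ler_sum => i _; exact: ler_norm.
have [F hF] : exists F : {fset I}, H - e / 2 < \sum_(i <- F) h i.
  apply: contrapT => /forallNP hF.
  suff : (H%:E <= (H - e / 2)%:E)%E by rewrite lee_fin; lra.
  by rewrite -HE; apply/esum_leP => F; rewrite leNgt; apply/negP; exact: hF.
have sF : \sum_(i <- F) g k i @[k --> \oo] --> 0.
  have := @cvg_bigsum _ F xpredT (fun i k => g k i) (fun=> 0) (fun i _ => gl i).
  by rewrite big1.
have e20 : 0 < e / 2 by lra.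
move/cvgrPdist_le : sF => /(_ _ e20); apply: filterS => k.
rewrite sub0r normrN ger0_norm ?sumr_ge0// => sFk.
apply/esum_leP => G; apply: (@le_trans _ _ (\sum_(i <- (F `|` G)%fset) g k i)).
  exact: sum_fset_le (fsubsetUr F G).
have split_sum (a : I -> R) : \sum_(i <- (F `|` G)%fset) a i =
    \sum_(i <- F) a i + \sum_(i <- (F `|` G)%fset) if i \in F then 0 else a i.
  have <- : \sum_(i <- (F `|` G)%fset) (if i \in F then a i else 0) =
      \sum_(i <- F) a i.
    rewrite (sum_fset_supp _ (fsubsetUl F G)).
      by apply: eq_big_seq => i ->.
    by move=> i /negPf ->.
  by rewrite -big_split; apply: eq_bigr => i _ /=; case: ifP;
    rewrite ?addr0 ?add0r.
have := sum_le_esum h (F `|` G)%fset.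
rewrite HE lee_fin (split_sum (g k)) (split_sum h).
have : \sum_(i <- (F `|` G)%fset) (if i \in F then 0 else g k i) <=
    \sum_(i <- (F `|` G)%fset) (if i \in F then 0 else h i).
  by apply: ler_sum => i _; case: ifP.
move: sFk hF; clear; move: (\sum_(i <- F) g k i) (\sum_(i <- F) h i).
move: (\sum_(i <- _) _) (\sum_(i <- _) _) => x y z u v.
lra.
Qed.

End Limits.

Section SquareSums.
Context (R : realType) (I : choiceType) (w : I -> R) (w0 : forall i, 0 <= w i).
Implicit Types (f g : I -> R) (a b c e : R).

Definition sqsum f : \bar R := \esum_(i in [set: I]) (w i * f i ^+ 2)%:E.

Definition wdot f g : R := rsum (fun i => w i * f i * g i).

Lemma sqsum_leP f c :
  (sqsum f <= c%:E)%E <->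
  forall F : {fset I}, \sum_(i <- F) w i * f i ^+ 2 <= c.
Proof. exact: esum_leP. Qed.

Lemma sqsum_ge0 f : (0 <= sqsum f)%E.
Proof. by apply: esum_ge0 => i _; rewrite lee_fin mulr_ge0// sqr_ge0. Qed.

Lemma sqsum_ltyP f : (sqsum f < +oo)%E <-> exists c, (sqsum f <= c%:E)%E.
Proof.
split=> [h|[c h]]; last by rewrite (le_lt_trans h)// ltry.
by exists (fine (sqsum f)); rewrite fineK// ge0_fin_numE// sqsum_ge0.
Qed.

Lemma sqsum_pt f c i : (sqsum f <= c%:E)%E -> w i * f i ^+ 2 <= c.
Proof. by move=> /sqsum_leP/(_ [fset i]%fset); rewrite big_seq_fset1. Qed.

Lemma sqsumD f g a b : (sqsum f <= a%:E)%E -> (sqsum g <= b%:E)%E ->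
  (sqsum (fun i => f i + g i)%R <= (2 * (a + b))%:E)%E.
Proof.
move=> /sqsum_leP hf /sqsum_leP hg; apply/sqsum_leP => F.
apply: (@le_trans _ _ (2 * (\sum_(i <- F) w i * f i ^+ 2 +
    \sum_(i <- F) w i * g i ^+ 2))); last by rewrite ler_pM2l// lerD.
rewrite -big_split mulr_sumr; apply: ler_sum => i _ /=; rewrite -subr_ge0.
rewrite (_ : _ - _ = w i * (f i - g i) ^+ 2); last by ring.
by rewrite mulr_ge0// sqr_ge0.
Qed.

Lemma sqsumZ f k a : (sqsum f <= a%:E)%E ->
  (sqsum (fun i => k * f i)%R <= (k ^+ 2 * a)%:E)%E.
Proof.
move=> /sqsum_leP hf; apply/sqsum_leP => F.
rewrite (@le_trans _ _ (k ^+ 2 * \sum_(i <- F) w i * f i ^+ 2))//.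
  by rewrite mulr_sumr; apply: ler_sum => i _; rewrite exprMn mulrCA.
by rewrite ler_wpM2l// sqr_ge0.
Qed.

Lemma sqsumN f a : (sqsum f <= a%:E)%E -> (sqsum (fun i => - f i)%R <= a%:E)%E.
Proof.
by move=> h; rewrite /sqsum; under eq_esum do rewrite sqrrN.
Qed.

Lemma sqsumB f g a b : (sqsum f <= a%:E)%E -> (sqsum g <= b%:E)%E ->
  (sqsum (fun i => f i - g i)%R <= (2 * (a + b))%:E)%E.
Proof. by move=> hf /sqsumN hg; exact: sqsumD hf hg. Qed.

(** Fatou's lemma for weighted sums of squares. *)
Lemma sqsum_cvg (f_ : nat -> I -> R) f c :
  (forall i, f_ k i @[k --> \oo] --> f i) ->
  (\forall k \near \oo, (sqsum (f_ k) <= c%:E)%E) -> (sqsum f <= c%:E)%E.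
Proof.
move=> fl fc; apply/sqsum_leP => F.
apply: (@cvg_le _ (fun k => \sum_(i <- F) w i * f_ k i ^+ 2)).
  apply: cvg_bigsum => i _; apply: cvgM; first exact: cvg_cst.
  by rewrite expr2; under eq_fun do rewrite expr2; exact: cvgM.
by apply: filterS fc => k /sqsum_leP.
Qed.

(** Young's inequality serves in place of the Cauchy-Schwarz inequality below:
the free parameter [e] makes up for the missing square roots. *)
Lemma young a b e : 0 < e -> `|a * b| <= (e * a ^+ 2 + e^-1 * b ^+ 2) / 2.
Proof.
move=> e0; set s := Num.sqrt e.
have s0 : 0 < s by rewrite sqrtr_gt0.
have es : e = s ^+ 2 by rewrite sqr_sqrtr// ltW.
have -> : e * a ^+ 2 + e^-1 * b ^+ 2 = (s * a) ^+ 2 + (s^-1 * b) ^+ 2.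
  by rewrite es -exprVn -!exprMn.
have -> : a * b = (s * a) * (s^-1 * b) by field; rewrite gt_eqF.
move: (s * a) (s^-1 * b) => x y; rewrite ler_norml.
by have := sqr_ge0 (x + y); have := sqr_ge0 (x - y); lra.
Qed.

Lemma wdot_sum_le f g a b e : (sqsum f <= a%:E)%E -> (sqsum g <= b%:E)%E ->
  0 < e -> forall F : {fset I},
  \sum_(i <- F) `|w i * f i * g i| <= (e * a + e^-1 * b) / 2.
Proof.
move=> /sqsum_leP hf /sqsum_leP hg e0 F.
apply: (@le_trans _ _ ((e * \sum_(i <- F) w i * f i ^+ 2 +
    e^-1 * \sum_(i <- F) w i * g i ^+ 2) / 2)).
  rewrite !mulr_sumr -big_split mulr_suml; apply: ler_sum => i _ /=.
  rewrite -mulrA normrM (ger0_norm (w0 i)).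
  rewrite (le_trans (ler_wpM2l (w0 i) (young _ _ e0)))//.
  by rewrite le_eqVlt; apply/orP; left; apply/eqP; ring.
have := ler_wpM2l (ltW e0) (hf F).
have /ltW/ler_wpM2l/(_ _ _ (hg F)) : 0 < e^-1 by rewrite invr_gt0.
lra.
Qed.

Lemma absum_wdot f g : (sqsum f < +oo)%E -> (sqsum g < +oo)%E ->
  absum (fun i => w i * f i * g i).
Proof.
move=> /sqsum_ltyP[a ha] /sqsum_ltyP[b hb].
by exists ((1 * a + 1^-1 * b) / 2); exact: wdot_sum_le.
Qed.

Lemma wdot_le f g a b e : (sqsum f <= a%:E)%E -> (sqsum g <= b%:E)%E ->
  0 < e -> `|wdot f g| <= (e * a + e^-1 * b) / 2.
Proof. by move=> ha hb e0; apply: rsum_le; exact: wdot_sum_le. Qed.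

Lemma wdotBr f g h : (sqsum f < +oo)%E -> (sqsum g < +oo)%E ->
  (sqsum h < +oo)%E -> wdot f (fun i => g i - h i) = wdot f g - wdot f h.
Proof.
move=> hf hg hh; rewrite /wdot -rsumB; [|exact: absum_wdot..].
by apply: eq_rsum => i; rewrite mulrBr.
Qed.

Lemma wdotC f g : wdot f g = wdot g f.
Proof. by apply: eq_rsum => i; rewrite mulrAC. Qed.

Lemma wdotBl f g h : (sqsum f < +oo)%E -> (sqsum g < +oo)%E ->
  (sqsum h < +oo)%E -> wdot (fun i => g i - h i) f = wdot g f - wdot h f.
Proof. by move=> hf hg hh; rewrite wdotC wdotBr// !(wdotC f). Qed.

End SquareSums.

(** * Exponentials of finite kernels *)

Section GeneratingFunction.
Context (R : realType).
Implicit Types (w : nat -> R) (t : R).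

(** The exponential generating function of [w]. *)
Definition egf w t : R := limn (pseries (fun n => w n / n`!%:R) t).

(** Geometric growth of [w] makes its exponential generating function entire,
and is stable under the shift of [w] that differentiates this function. *)
Definition geo_bounded w : Prop :=
  exists B C, [/\ 0 <= B, 0 <= C & forall n, `|w n| <= B * C ^+ n].

Lemma geo_boundedS w : geo_bounded w -> geo_bounded (fun n => w n.+1).
Proof.
move=> [B [C [B0 C0 h]]]; exists (B * C), C; split => //; first exact: mulr_ge0.
by move=> n; rewrite -mulrA -exprS.
Qed.

Lemma is_cvg_egf w t : geo_bounded w ->
  cvgn (pseries (fun n => w n / n`!%:R) t).
Proof.
move=> [B [C [B0 C0 h]]]; apply: normed_cvg.
have Ct0 : 0 <= C * `|t| by rewrite mulr_ge0.
apply: (@series_le_cvg _ _ (fun n => B *: exp_coeff (C * `|t|) n)) => [n|n|n|].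
- exact: normr_ge0.
- by rewrite /exp_coeff mulr_ge0// divr_ge0// exprn_ge0.
- have -> : B *: exp_coeff (C * `|t|) n =
      B * C ^+ n * (n`!%:R^-1 * `|t| ^+ n).
    by rewrite /exp_coeff /= exprMn /GRing.scale/=; ring.
  rewrite /= !normrM normfV normrX (ger0_norm (ler0n _ _)) -mulrA.
  by rewrite ler_wpM2r// mulr_ge0 ?invr_ge0 ?exprn_ge0.
- by apply: is_cvg_seriesZ; exact: is_cvg_series_exp_coeff.
Qed.

Lemma cvg_egf w t : geo_bounded w ->
  pseries (fun n => w n / n`!%:R) t n @[n --> \oo] --> egf w t.
Proof. exact: is_cvg_egf. Qed.

Lemma is_derive_egf w t : geo_bounded w ->
  is_derive t (1 : R) (egf w) (egf (fun n => w n.+1) t).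
Proof.
move=> hw.
have diffsE v : pseries_diffs (fun n => v n / n`!%:R) =
    (fun n => v n.+1 / n`!%:R) :> (nat -> R).
  apply/funext => n; rewrite /pseries_diffs factS natrM invfM.
  by rewrite mulrCA mulVKf// pnatr_eq0.
have hw1 := geo_boundedS hw; have hw2 := geo_boundedS hw1.
rewrite /egf -diffsE; apply: (@pseries_snd_diffs _ _ (`|t| + 1)).
- exact: is_cvg_egf.
- by rewrite diffsE; exact: is_cvg_egf.
- by rewrite diffsE (diffsE (fun n => w n.+1)); exact: is_cvg_egf.
- by rewrite [ltRHS]ger0_norm ?addr_ge0// ltrDl.
Qed.

Lemma egf0 w : egf w 0 = w 0%N.
Proof.
apply: cvg_lim => //; apply: cvg_near_cst; exists 1%N => // -[//|n] /= _.
rewrite /pseries /series /= big_nat_recl//= expr0 fact0 divr1 mulr1.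
by rewrite big1 ?addr0// => i _; rewrite expr0n mulr0.
Qed.

Lemma egf_le w w' t : geo_bounded w -> geo_bounded w' -> 0 <= t ->
  (forall n, w n <= w' n) -> egf w t <= egf w' t.
Proof.
move=> hw hw' t0 ww'; apply: ler_lim; [exact: is_cvg_egf..|].
apply: nearW => n; apply: ler_sum => i _ /=.
by rewrite ler_wpM2r ?exprn_ge0// ler_wpM2r// invr_ge0.
Qed.

Lemma egf_cst0 t : egf (fun=> 0) t = 0.
Proof.
rewrite /egf (_ : pseries _ t = fun=> 0) ?lim_cst//; apply/funext => n.
by rewrite /pseries /series /= big1// => i _; rewrite !mul0r.
Qed.

Lemma egf_ge0 w t : geo_bounded w -> 0 <= t -> (forall n, 0 <= w n) ->
  0 <= egf w t.
Proof.
move=> hw t0 w0; rewrite -(egf_cst0 t); apply: egf_le => //.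
by exists 0, 0; split => // n; rewrite normr0 mul0r.
Qed.

Lemma egf_sum (J : Type) (r : seq J) (c : J -> R) (w : J -> nat -> R) t :
  (forall j, geo_bounded (w j)) ->
  egf (fun n => \sum_(j <- r) c j * w j n) t = \sum_(j <- r) c j * egf (w j) t.
Proof.
move=> hw; apply: cvg_lim => //.
rewrite (_ : pseries _ t = fun k =>
    \sum_(j <- r) c j * pseries (fun n => w j n / n`!%:R) t k).
  by apply: cvg_bigsum => j _; apply: cvgM; [exact: cvg_cst|exact: cvg_egf].
apply/funext => k; rewrite /pseries /series /=.
under [RHS]eq_bigr do rewrite mulr_sumr.
rewrite exchange_big/=; apply: eq_bigr => i _.
by rewrite !mulr_suml; apply: eq_bigr => j _; rewrite !mulrA.
Qed.

Lemma is_derive_bigsum (J : eqType) (r : seq J) (f : J -> R -> R)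
    (df : J -> R) t :
  (forall j, j \in r -> is_derive t (1 : R) (f j) (df j)) ->
  is_derive t (1 : R) (fun s => \sum_(j <- r) f j s) (\sum_(j <- r) df j).
Proof.
elim: r => [|j r IH] h.
  by rewrite big_nil; under eq_fun do rewrite big_nil; exact: is_derive_cst.
rewrite big_cons; under eq_fun do rewrite big_cons.
apply: is_deriveD; first by apply: h; rewrite mem_head.
by apply: IH => i ir; apply: h; rewrite inE ir orbT.
Qed.

End GeneratingFunction.

Section KernelExponential.
Context (R : realType) (X : choiceType) (F : {fset X}) (a : X -> X -> R).
Implicit Types (v : X -> R) (x y z : X) (s t : R).

Definition kop v x : R := \sum_(z <- F) a x z * v z.

Definition kpow n x y : R := iter n kop (fun z => (z == y)%:R) x.

Arguments kpow : simpl never.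

(** With [kop] the operator of the kernel [a] restricted to the finite set [F],
the function [kexp t x y] is the entry [(x, y)] of its exponential at time [t].
Entries are indexed by the whole vertex set, so that kernels on different finite
sets can be compared; only those with [x] in [F] are meaningful. *)
Definition kexp t x y : R := egf (fun n => kpow n x y) t.

Let C : R := \sum_(x <- F) \sum_(z <- F) `|a x z|.

Let C0 : 0 <= C.
Proof. by apply: sumr_ge0 => x _; apply: sumr_ge0. Qed.

Let kpow_in n x y : x \in F -> `|kpow n x y| <= C ^+ n.
Proof.
elim: n x => [|n IH] x xF; first by rewrite /kpow /= expr0; case: eqP;
  rewrite ?normr1 ?normr0.
rewrite /kpow iterS -/(kpow n) /kop exprS (le_trans (ler_norm_sum _ _ _))//.
rewrite (@le_trans _ _ (\sum_(z <- F) `|a x z| * C ^+ n))//.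
  by rewrite !big_seq; apply: ler_sum => z zF; rewrite normrM ler_wpM2l// IH.
rewrite -mulr_suml ler_wpM2r ?exprn_ge0//.
rewrite [leRHS](big_fsetD1 x)//= lerDl.
by apply: sumr_ge0 => z _; apply: sumr_ge0.
Qed.

Lemma geo_bounded_kpow x y : geo_bounded (fun n => kpow n x y).
Proof.
pose Cx := \sum_(z <- F) `|a x z|; have Cx0 : 0 <= Cx by apply: sumr_ge0.
exists 1, (Cx + C); split; rewrite ?addr_ge0// => n; rewrite mul1r.
case: n => [|n]; first by rewrite /kpow /= expr0; case: eqP;
  rewrite ?normr1 ?normr0.
rewrite /kpow iterS /kop exprS (le_trans (ler_norm_sum _ _ _))//.
rewrite (@le_trans _ _ (\sum_(z <- F) `|a x z| * C ^+ n))//.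
  rewrite !big_seq; apply: ler_sum => z zF; rewrite normrM ler_wpM2l//.
  exact: kpow_in.
rewrite -mulr_suml ler_pM ?exprn_ge0 ?lerDl// ?lerXn2r ?nnegrE ?addr_ge0//.
by rewrite lerDr.
Qed.

Lemma kpowS n x y : kpow n.+1 x y = \sum_(z <- F) a x z * kpow n z y.
Proof. by []. Qed.

(** The powers of the kernel commute with the kernel. *)
Lemma kpowSr n x y : x \in F -> y \in F ->
  kpow n.+1 x y = \sum_(z <- F) kpow n x z * a z y.
Proof.
move=> + yF; elim: n x => [|n IH] x xF.
  rewrite kpowS (big_fsetD1 y)//= [RHS](big_fsetD1 x)//=.
  rewrite /kpow /= !eqxx mulr1 mul1r !big1_fset ?addr0// => z.
    by rewrite !inE eq_sym => /andP[/negPf -> _] _; rewrite mul0r.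
  by rewrite !inE => /andP[/negPf -> _] _; rewrite mulr0.
rewrite kpowS; under [RHS]eq_bigr do rewrite kpowS mulr_suml.
rewrite exchange_big/= big_seq [RHS]big_seq; apply: eq_bigr => z zF.
by rewrite IH// mulr_sumr; apply: eq_bigr => w _; rewrite mulrA.
Qed.

Lemma kexp0 x y : kexp 0 x y = (x == y)%:R.
Proof. by rewrite /kexp egf0. Qed.

Lemma is_derive_kexp t x y :
  is_derive t (1 : R) (fun s => kexp s x y) (\sum_(z <- F) a x z * kexp t z y).
Proof.
have := is_derive_egf t (geo_bounded_kpow x y).
by rewrite egf_sum// => z; exact: geo_bounded_kpow.
Qed.

Lemma is_derive_kexp_r t x y : x \in F -> y \in F ->
  is_derive t (1 : R) (fun s => kexp s x y) (\sum_(z <- F) kexp t x z * a z y).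
Proof.
move=> xF yF; have := is_derive_egf t (geo_bounded_kpow x y).
rewrite (_ : (fun n => kpow n.+1 x y) =
    fun n => \sum_(z <- F) a z y * kpow n x z); last first.
  by apply/funext => n; rewrite kpowSr//; apply: eq_bigr => z _; rewrite mulrC.
rewrite egf_sum; last by move=> z; exact: geo_bounded_kpow.
by under eq_bigr do rewrite mulrC.
Qed.

(** If [u' = a u], then [exp((t - s) a) u(s)] has zero derivative in [s];
compare [s = 0] with [s = t]. The semigroup law, the effect of a diagonal shift
and the row sums of the exponential are instances. *)
Lemma kexp_unique (u : R -> X -> R) :
  (forall s x, x \in F ->
    is_derive s (1 : R) (fun r => u r x) (\sum_(z <- F) a x z * u s z)) ->
  forall t x, x \in F -> u t x = \sum_(y <- F) kexp t x y * u 0 y.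
Proof.
move=> hu t x xF.
pose U s := \sum_(y <- F) kexp (t - s) x y * u s y.
have U0 : U 0 = \sum_(y <- F) kexp t x y * u 0 y by rewrite /U subr0.
have Ut : U t = u t x.
  rewrite /U subrr (big_fsetD1 x)//= kexp0 eqxx mul1r big1_fset ?addr0// => z.
  by rewrite kexp0 !inE eq_sym => /andP[/negPf -> _] _; rewrite mul0r.
rewrite -U0 -Ut; apply: is_derive_0_is_cst => s.
have -> : (0 : R) = \sum_(y <- F) (kexp (t - s) x y * (\sum_(z <- F) a y z * u
  s z) -
   u s y * (\sum_(z <- F) kexp (t - s) x z * a z y)).
  rewrite sumrB; apply/esym/eqP; rewrite subr_eq0; apply/eqP.
  under eq_bigr do rewrite mulr_sumr.
  rewrite exchange_big/=; apply: eq_bigr => y _; rewrite mulr_sumr.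
  by apply: eq_bigr => z _; ring.
apply: is_derive_bigsum => y yF.
rewrite -mulrN.
apply: is_deriveM; last exact: hu.
rewrite -[X in is_derive _ _ _ X]mulrN1.
apply: (@is_derive1_comp _ (fun r => kexp r x y) (fun r => t - r)).
  exact: is_derive_kexp_r.
by rewrite -[X in is_derive _ _ _ X]sub0r; apply: is_deriveB.
Qed.

End KernelExponential.

Arguments kpow : simpl never.

Section KernelExponentialProperties.
Context (R : realType) (X : choiceType).
Implicit Types (F : {fset X}) (a : X -> X -> R) (x y z : X) (s t c : R).

Lemma sum_delta F (v : X -> R) y : y \in F ->
  \sum_(z <- F) v z * (z == y)%:R = v y.
Proof.
move=> yF; rewrite (big_fsetD1 y)//= eqxx mulr1 big1_fset ?addr0// => z.
by rewrite !inE => /andP[/negPf -> _] _; rewrite mulr0.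
Qed.

Lemma kexpD F a s t x y : x \in F ->
  kexp F a (s + t) x y = \sum_(z <- F) kexp F a s x z * kexp F a t z y.
Proof.
pose u r z := kexp F a (r + t) z y => xF.
have hu r z : z \in F ->
    is_derive r (1 : R) (u ^~ z) (\sum_(w <- F) a z w * u r w).
  move=> zF; rewrite -[X in is_derive _ _ _ X]mulr1.
  apply: (@is_derive1_comp _ (fun r => kexp F a r z y) (fun r => r + t)).
    exact: is_derive_kexp.
  by rewrite -[X in is_derive _ _ _ X]addr0; apply: is_deriveD.
by have := kexp_unique hu s xF; rewrite /u add0r.
Qed.

(** Adding [c] to the diagonal multiplies the exponential by [exp(c t)], which
reduces sign questions to kernels whose diagonal is nonnegative too. *)
Lemma kexp_shift F a c t x y : x \in F -> y \in F ->
  kexp F a t x y =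
  expR (- c * t) * kexp F (fun x y => a x y + c * (x == y)%:R) t x y.
Proof.
move=> xF yF; set a' := fun x y => _.
pose u r z := expR (- c * r) * kexp F a' r z y.
suff hu r z : z \in F ->
    is_derive r (1 : R) (u ^~ z) (\sum_(w <- F) a z w * u r w).
  rewrite -/(u t x) (kexp_unique hu t xF) /u.
  under eq_bigr do rewrite mulr0 expR0 mul1r kexp0.
  by rewrite sum_delta.
move=> zF; rewrite /u; set k := kexp F a' r ^~ y.
have -> : \sum_(w <- F) a z w * (expR (- c * r) * k w) =
    expR (- c * r) * (\sum_(w <- F) a' z w * k w) + k z * (expR (- c * r) * -
      c).
  have -> : \sum_(w <- F) a' z w * k w = \sum_(w <- F) a z w * k w + c * k z.
    rewrite -(sum_delta (fun w => c * k w) zF) -big_split.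
    by apply: eq_bigr => w _; rewrite /a' eq_sym /=; ring.
  rewrite mulrDr -addrA (_ : expR _ * (c * _) + _ = 0); last by ring.
  by rewrite addr0 mulr_sumr; apply: eq_bigr => w _; ring.
apply: is_deriveM; last exact: is_derive_kexp.
apply: (@is_derive1_comp _ expR (fun r => - c * r)).
by rewrite -[X in is_derive _ _ _ X]mulr1; exact: is_deriveZ.
Qed.

Lemma kpow_le F F' a a' n x y : (F `<=` F')%fset ->
  (forall x y, x \in F -> y \in F -> 0 <= a x y <= a' x y) ->
  (forall x y, x \in F' -> y \in F' -> 0 <= a' x y) ->
  (x \in F -> y \in F -> 0 <= kpow F a n x y <= kpow F' a' n x y) /\
  (x \in F' -> y \in F' -> 0 <= kpow F' a' n x y).
Proof.
move=> FF' aa' a'0.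
have pos : forall x, x \in F' -> y \in F' -> 0 <= kpow F' a' n x y.
  elim: n => [|n IH] {}x xF' yF'; first by rewrite /kpow/= ler0n.
  rewrite kpowS big_seq; apply: sumr_ge0 => z zF'.
  by rewrite mulr_ge0 ?a'0 ?IH.
split; last exact: pos; move: x.
elim: n pos => [|n IH] pos x xF yF; first by rewrite /kpow/= ler0n lexx.
have posn z : z \in F' -> y \in F' -> 0 <= kpow F' a' n z y.
  move=> {IH pos}; elim: n z => [|n IH] z zF' yF';
    first by rewrite /kpow/= ler0n.
  rewrite kpowS big_seq; apply: sumr_ge0 => w wF'.
  by rewrite mulr_ge0 ?a'0 ?IH.
rewrite !kpowS; apply/andP; split.
  rewrite big_seq; apply: sumr_ge0 => z zF.
  by have /andP[a0 _] := aa' _ _ xF zF; have /andP[? _] := IH posn z zF yF;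
     rewrite mulr_ge0.
pose g z := if z \in F' then a' x z * kpow F' a' n z y else 0.
have -> : \sum_(z <- F') a' x z * kpow F' a' n z y = \sum_(z <- F') g z.
  by apply: eq_big_seq => z zF'; rewrite /g zF'.
apply: (@le_trans _ _ (\sum_(z <- F) g z)).
  rewrite !big_seq; apply: ler_sum => z zF.
  rewrite /g (fsubsetP FF')//.
  have /andP[a0 aa] := aa' _ _ xF zF; have /andP[k0 kk] := IH posn z zF yF.
  exact: ler_pM.
apply: sum_fset_le => // z; rewrite /g; case: ifP => // zF'.
by rewrite mulr_ge0 ?a'0 ?posn// (fsubsetP FF').
Qed.

(** After adding a large constant to the diagonal, all entries are nonnegative,
and the powers of the kernels can be compared entry by entry. *)
Lemma kexp_le F F' a a' t x y : (F `<=` F')%fset ->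
  (forall x y, x \in F -> y \in F -> x != y -> 0 <= a x y) ->
  (forall x y, x \in F' -> y \in F' -> x != y -> 0 <= a' x y) ->
  (forall x y, x \in F -> y \in F -> a x y <= a' x y) ->
  0 <= t -> x \in F -> y \in F ->
  0 <= kexp F a t x y <= kexp F' a' t x y.
Proof.
move=> FF' aoff a'off aa' t0 xF yF.
have [xF' yF'] : x \in F' /\ y \in F' by rewrite !(fsubsetP FF').
(* With this constant both shifted diagonals are nonnegative. *)
pose c := \sum_(z <- F) `|a z z| + \sum_(z <- F') `|a' z z|.
have le_sum (G : {fset X}) (b : X -> X -> R) z :
    z \in G -> - b z z <= \sum_(w <- G) `|b w w|.
  move=> zG; rewrite (big_fsetD1 z)//= -normrN (le_trans (ler_norm _))// lerDl.
  exact: sumr_ge0.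
have s0 (G : {fset X}) (b : X -> X -> R) : 0 <= \sum_(w <- G) `|b w w|.
  exact: sumr_ge0.
rewrite (@kexp_shift F a c)// (@kexp_shift F' a' c)//.
have pF z w : z \in F -> w \in F ->
    0 <= a z w + c * (z == w)%:R <= a' z w + c * (z == w)%:R.
  move=> zF wF; rewrite lerD2r aa'// andbT.
  have [<-|zw] := eqVneq z w; last by rewrite mulr0 addr0 aoff.
  by rewrite mulr1 /c; have := le_sum _ a _ zF; have := s0 F' a'; lra.
have pF' z w : z \in F' -> w \in F' -> 0 <= a' z w + c * (z == w)%:R.
  move=> zF wF; have [<-|zw] := eqVneq z w; last by rewrite mulr0 addr0 a'off.
  by rewrite mulr1 /c; have := le_sum _ a' _ zF; have := s0 F a; lra.
have kp n := (kpow_le n x y FF' pF pF').1 xF yF.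
rewrite mulr_ge0 ?expR_ge0//=; last first.
  apply: egf_ge0 => //; first exact: geo_bounded_kpow.
  by move=> n; have /andP[] := kp n.
rewrite ler_wpM2l ?expR_ge0//; apply: egf_le => //.
- exact: geo_bounded_kpow.
- exact: geo_bounded_kpow.
- by move=> n; have /andP[] := kp n.
Qed.

Lemma kexp_sym F a (m : X -> R) t x y :
  (forall x y, x \in F -> y \in F -> m x * a x y = m y * a y x) ->
  x \in F -> y \in F -> m x * kexp F a t x y = m y * kexp F a t y x.
Proof.
move=> ma xF yF.
have kp n x' : x' \in F -> m x' * kpow F a n x' y = m y * kpow F a n y x'.
  elim: n x' => [|n IH] x' x'F.
    by rewrite /kpow /= eq_sym; case: eqP => [->//|_]; rewrite !mulr0.
  rewrite kpowS kpowSr// !mulr_sumr big_seq [RHS]big_seq.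
  apply: eq_bigr => z zF; rewrite mulrA ma// mulrAC IH//; ring.
have := egf_sum [:: tt] (fun=> m x) t (fun=> geo_bounded_kpow F a x y).
have := egf_sum [:: tt] (fun=> m y) t (fun=> geo_bounded_kpow F a y x).
rewrite !big_seq1 => <- <-; congr egf; apply/funext => n.
by rewrite !big_seq1 kp.
Qed.

Lemma kexp_row1 F a t x :
  (forall x, x \in F -> \sum_(y <- F) a x y = 0) -> x \in F ->
  \sum_(y <- F) kexp F a t x y = 1.
Proof.
move=> ha xF.
have hu (s : R) z : z \in F ->
    is_derive s (1 : R) (fun _ => 1 : R) (\sum_(w <- F) a z w * 1).
  move=> zF; under eq_bigr do rewrite mulr1.
  by rewrite ha//; exact: is_derive_cst.
rewrite [RHS](@kexp_unique _ _ F a (fun _ _ => 1) hu t x xF).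
by apply: eq_bigr => y _; rewrite mulr1.
Qed.

End KernelExponentialProperties.

(** * Uniqueness for the abstract Cauchy problem in l2 *)

Section RealLemmas.
Context (R : realType).

Lemma flat_is_derive (g : R -> R) s :
  (forall e, 0 < e -> exists2 d, 0 < d &
     forall r, `|r - s| < d -> `|g r - g s| <= e * `|r - s|) ->
  is_derive s (1 : R) g 0.
Proof.
move=> h.
have cv : h^-1 *: ((g \o shift s) (h *: (1 : R)) - g s) @[h --> 0^'] --> (0 :
  R).
  apply/cvgrPdist_le => e e0; have [d d0 hd] := h e e0.
  exists d => //= r /=; rewrite sub0r normrN => rd r0.
  rewrite sub0r normrN normrM normfV.
  have := hd (r + s); rewrite addrK => /(_ rd).
  rewrite -[r *: 1]/(r * 1) mulr1.
  by rewrite ler_pdivrMl ?normr_gt0// mulrC.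
apply: DeriveDef; first by apply/cvg_ex; exists 0.
exact: cvg_lim cv.
Qed.

(** A function on a segment whose derivative vanishes at each point, one-sidedly
at the end points, is constant: it extends by constants to the line. *)
Lemma flat_on_segment (f : R -> R) t : 0 <= t ->
  (forall s, 0 <= s <= t -> forall e, 0 < e -> exists2 d, 0 < d &
     forall r, 0 <= r <= t -> `|r - s| < d -> `|f r - f s| <= e * `|r - s|) ->
  f t = f 0.
Proof.
move=> t0 h; pose cl (r : R) := Num.max 0 (Num.min r t).
have cl01 r : 0 <= cl r <= t.
  by rewrite /cl le_max lexx/= ge_max t0 ge_min lexx orbT.
have cl_lip r s : `|cl r - cl s| <= `|r - s|.
  rewrite /cl; case: (leP r t) => ?; case: (leP s t) => ?;
  case: (leP 0 r) => ?; case: (leP 0 s) => ?; rewrite ?(max_r t0);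
  by rewrite ler_norml; case: (ger0P (r - s)) => ?; apply/andP; split; lra.
have -> : f t = (f \o cl) t by rewrite /= /cl minxx max_r.
have -> : f 0 = (f \o cl) 0 by rewrite /= /cl min_l// maxxx.
apply: is_derive_0_is_cst => s; apply: flat_is_derive => e e0.
have [d d0 hd] := h _ (cl01 s) e e0; exists d => // r rs.
rewrite (le_trans (hd _ (cl01 r) _))// ?(le_lt_trans (cl_lip _ _))//.
by rewrite ler_wpM2l// ltW.
Qed.

Lemma cvge0_near_le (T : Type) (F : set_system T) {FF : Filter F}
    (f : T -> \bar R) : f t @[t --> F] --> 0%E ->
  forall e, 0 < e -> \forall t \near F, (f t <= e%:E)%E.
Proof.
move=> /fine_cvgP[ffin /cvgrPdist_le fl] e e0.
near=> t; have ft : f t \is a fin_num by near: t.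
rewrite -(fineK ft) lee_fin (le_trans (ler_norm _))//.
by rewrite -normrN -sub0r; near: t; exact: fl.
Unshelve. all: by end_near. Qed.

Lemma near_le_cvge0 (T : Type) (F : set_system T) {FF : Filter F}
    (f : T -> \bar R) : (forall t, (0 <= f t)%E) ->
  (forall e, 0 < e -> \forall t \near F, (f t <= e%:E)%E) ->
  f t @[t --> F] --> 0%E.
Proof.
move=> f0 h.
have fin t e : (f t <= e%:E)%E -> f t \is a fin_num.
  by move=> fe; rewrite ge0_fin_numE// (le_lt_trans fe)// ltry.
apply/fine_cvgP; split.
  by apply: filterS (h 1 ltr01) => t; exact: fin.
apply/cvgrPdist_le => e e0; apply: filterS (h e e0) => t fe.
by rewrite sub0r normrN ger0_norm ?fine_ge0// -lee_fin fineK//; exact: fin fe.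
Qed.

Lemma cvg_right0_le (F : R -> \bar R) : F t @[t --> 0^'+] --> 0%E ->
  forall e, 0 < e -> exists2 d, 0 < d &
    forall t, 0 < t -> t < d -> (F t <= e%:E)%E.
Proof.
move=> cv e e0; have [d /= d0 hd] := cvge0_near_le cv e0.
exists d => // t t0 td.
by apply: hd => //=; rewrite sub0r normrN gtr0_norm.
Qed.

End RealLemmas.

Section L2Operators.
Context (R : realType) (X : countType) (m : X -> R).
Hypothesis hm : forall x, 0 < m x.
Implicit Types (f g : X -> R) (a b c : R).

Let m0 x : 0 <= m x. Proof. exact: ltW. Qed.

Lemma l2norm_sqE f : l2norm_sq m f = sqsum m f.
Proof.
by apply: eq_esum => x _; rewrite real_normK ?num_real// mulrC.
Qed.

Lemma in_l2P f : in_l2 m f <-> exists c, (sqsum m f <= c%:E)%E.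
Proof. by rewrite /in_l2 l2norm_sqE; exact: sqsum_ltyP. Qed.

Lemma in_l2_le f c : (sqsum m f <= c%:E)%E -> in_l2 m f.
Proof. by move=> h; apply/in_l2P; exists c. Qed.

Lemma in_l2D f g : in_l2 m f -> in_l2 m g -> in_l2 m (fun x => f x + g x).
Proof.
by move=> /in_l2P[a ha] /in_l2P[b hb]; exact: in_l2_le (sqsumD m0 ha hb).
Qed.

Lemma in_l2Z f k : in_l2 m f -> in_l2 m (fun x => k * f x).
Proof. by move=> /in_l2P[a ha]; exact: in_l2_le (sqsumZ _ ha). Qed.

Lemma in_l2B f g : in_l2 m f -> in_l2 m g -> in_l2 m (fun x => f x - g x).
Proof.
by move=> /in_l2P[a ha] /in_l2P[b hb]; exact: in_l2_le (sqsumB m0 ha hb).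
Qed.

Lemma l2_eq f g :
  (forall e, 0 < e -> (sqsum m (fun x => f x - g x)%R <= e%:E)%E) ->
  f = g.
Proof.
move=> h; apply/funext => x; apply/eqP; rewrite -subr_eq0 -sqrf_eq0.
rewrite eq_le sqr_ge0 andbT; apply/ler_addgt0Pl => e e0; rewrite addr0.
have := sqsum_pt x (h _ (mulr_gt0 (hm x) e0)).
by rewrite ler_pM2l.
Qed.

Section Operator.
Variable T : (X -> R) -> (X -> R).
Hypothesis hT : bounded_l2_operator m T.

Lemma op_in_l2 f : in_l2 m f -> in_l2 m (T f).
Proof. by case: hT => h _ _; exact: h. Qed.

Lemma opB f g : in_l2 m f -> in_l2 m g ->
  T (fun x => f x - g x) = (fun x => T f x - T g x).
Proof.
case: hT => _ lin _ hf hg.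
have -> : (fun x => f x - g x) = (- 1) *: g + f.
  by apply/funext => x; rewrite -[RHS]/(- 1 * g x + f x) mulN1r addrC.
rewrite lin//; apply/funext => x.
by rewrite -[LHS]/(- 1 * T g x + T f x) mulN1r addrC.
Qed.

Lemma opD f g : in_l2 m f -> in_l2 m g ->
  T (fun x => f x + g x) = (fun x => T f x + T g x).
Proof.
case: hT => _ lin _ hf hg.
have -> : (fun x => f x + g x) = 1 *: f + g.
  by apply/funext => x; rewrite scale1r.
by rewrite lin// scale1r.
Qed.

Lemma opZ f k : in_l2 m f -> T (fun x => k * f x) = (fun x => k * T f x).
Proof.
move=> hf.
have T0 : T (fun=> 0) = fun=> 0.
  have := opB hf hf; have -> : (fun x => f x - f x) = fun=> 0.
    by apply/funext => x; rewrite subrr.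
  by move=> ->; apply/funext => x; rewrite subrr.
case: hT => _ lin _.
have h0 : in_l2 m (fun=> 0).
  by apply: (@in_l2_le _ 0); apply/sqsum_leP => F; rewrite big1// => x _;
    rewrite expr0n mulr0.
have -> : (fun x => k * f x) = k *: f + (fun=> 0).
  by apply/funext => x; rewrite -[RHS]/(k * f x + 0) addr0.
rewrite lin// T0; apply/funext => x.
by rewrite -[LHS]/(k * T f x + 0) addr0.
Qed.

Lemma op_bounded : exists2 C, 0 <= C &
  forall f c, (sqsum m f <= c%:E)%E -> (sqsum m (T f) <= (C * c)%:E)%E.
Proof.
case: hT => _ _ [C hC]; exists `|C| => // f c fc.
have := hC _ (in_l2_le fc); rewrite !l2norm_sqE => /le_trans; apply.
rewrite EFinM (@le_trans _ _ (`|C|%:E * sqsum m f)%E)//.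
  by rewrite lee_wpmul2r ?lee_fin ?ler_norm// sqsum_ge0.
by rewrite lee_wpmul2l ?lee_fin.
Qed.

End Operator.

Section LocalBound.
Variable P : R -> (X -> R) -> (X -> R).
Hypothesis hP : C0_semigroup m P.

Lemma C0_bounded t : 0 <= t -> bounded_l2_operator m (P t).
Proof. by case: hP => h _ _ _; exact: h. Qed.

Definition bound_on d M : Prop := forall h f c,
  0 <= h <= d -> (sqsum m f <= c%:E)%E ->
  (sqsum m (P h f) <= (M * c)%:E)%E.

(** One step of the gliding hump. If no operator norm bound holds for small
times, some small time [h] and some small [xi] make [P h xi] large; then one of
[P h (x + xi)] and [P h (x - xi)] is at least as large, and by boundedness of [P
h] it stays large on a small ball around [x + xi] or [x - xi]. *)
Lemma shrinking_ball_step n (x : X -> R) (r : R) :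
  (forall d M, 0 < d -> 0 <= M -> ~ bound_on d M) -> 0 < r -> in_l2 m x ->
  exists (x' : X -> R) (r' h : R),
  [/\ in_l2 m x', 0 < r' <= r / 16, 0 <= h <= n.+1%:R^-1,
     (sqsum m (fun z => x' z - x z)%R <= r%:E)%E &
     forall y, (sqsum m (fun z => y z - x' z)%R <= (4 * r')%:E)%E ->
       ~ (sqsum m (P h y) <= n%:R%:E)%E].
Proof.
move=> unb r0 xl2; pose B : R := 2 * (n%:R + 1).
have B0 : 0 <= B by rewrite /B mulr_ge0 ?addr_ge0.
have n1 : 0 < n.+1%:R^-1 :> R by rewrite invr_gt0.
have /existsNP[h] := unb _ _ n1 (divr_ge0 B0 (ltW r0)).
move=> /existsNP[f] /existsNP[c] /not_implyP[hn] /not_implyP[fc] nP.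
have h0 : 0 <= h by case/andP: hn.
have [C C0 hC] := op_bounded (C0_bounded h0).
have c0 : 0 < c.
  rewrite lt_neqAle.
  have -> : 0 <= c by rewrite -lee_fin (le_trans _ fc)// sqsum_ge0.
  rewrite andbT; apply/eqP => c0; apply: nP; rewrite -c0 mulr0.
  by have := hC _ _ fc; rewrite -c0 mulr0.
(* Rescale [f] so that the bound [c] on its square norm becomes [r]. *)
pose k := Num.sqrt (r / c).
have k2 : k ^+ 2 = r / c by rewrite sqr_sqrtr// ltW// divr_gt0.
have k0 : 0 < k by rewrite sqrtr_gt0 divr_gt0.
pose xi z := k * f z.
have fl2 := in_l2_le fc.
have xil2 : in_l2 m xi by exact: in_l2Z.
have xir : (sqsum m xi <= r%:E)%E.
  by have := sqsumZ k fc; rewrite k2 divfK ?gt_eqF.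
have nxi : ~ (sqsum m (P h xi) <= B%:E)%E.
  rewrite /xi (opZ (C0_bounded h0) k fl2) => /(@sqsumZ _ _ _ _ k^-1 _).
  rewrite (_ : (fun i => k^-1 * _) = P h f); last first.
    by apply/funext => z; rewrite mulKf ?gt_eqF.
  rewrite exprVn k2 invf_div => hh; apply: nP.
  by rewrite mulrAC [B * c]mulrC mulrAC.
have [x' [x'l2 x'x nx']] : exists x' : X -> R, [/\ in_l2 m x',
    (sqsum m (fun z => x' z - x z)%R <= r%:E)%E &
    ~ (sqsum m (P h x') <= B%:E)%E].
  apply: contrapT => /forallNP no.
  have plus : (sqsum m (P h (fun z => x z + xi z)%R) <= B%:E)%E.
    apply: contrapT => np; apply: (no (fun z => x z + xi z)); split => //.
      exact: in_l2D.
    by rewrite (_ : (fun z => _) = xi)//; apply/funext => z;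
      rewrite addrC addKr.
  have minus : (sqsum m (P h (fun z => x z - xi z)%R) <= B%:E)%E.
    apply: contrapT => np; apply: (no (fun z => x z - xi z)); split => //.
      exact: in_l2B.
    rewrite (_ : (fun z => _) = fun z => - xi z); first exact: sqsumN.
    by apply/funext => z; rewrite addrC addKr.
  apply: nxi; have := sqsumZ 2^-1 (sqsumB m0 plus minus).
  rewrite (opD (C0_bounded h0))// (opB (C0_bounded h0))//.
  rewrite (_ : (fun i => _) = P h xi); last by apply/funext => z; field.
  by move/le_trans; apply; rewrite lee_fin; lra.
have C1 : 0 < 4 * (C + 1) by rewrite mulr_gt0// ltr_wpDl.
exists x', (Num.min (r / 16) (4 * (C + 1))^-1), h; split => //.
  by rewrite lt_min divr_gt0//= invr_gt0 C1/= ge_min lexx.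
move=> y yx' yn; apply: nx'.
have yl2 : in_l2 m y.
  have -> : y = fun z => (y z - x' z) + x' z.
    by apply/funext => z; rewrite subrK.
  by apply: in_l2D => //; exact: in_l2_le yx'.
have := sqsumB m0 yn (hC _ _ yx').
rewrite (opB (C0_bounded h0))//.
rewrite (_ : (fun i => _) = P h x'); last by apply/funext => z; lra.
move/le_trans; apply; rewrite lee_fin /B ler_pM2l// lerD2l.
have := ler_wpM2l C0 (_ : 4 * Num.min (r / 16) (4 * (C + 1))^-1 <= (C + 1)^-1).
move=> /(_ _)/le_trans; apply.
  by rewrite -ler_pdivlMl// -invfM ge_min lexx orbT.
by rewrite ler_pdivrMr ?ltr_wpDl// mul1r lerDl.
Qed.

Lemma C0_near0 f : in_l2 m f -> forall e, 0 < e -> exists2 d, 0 < d &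
  forall h, 0 <= h < d -> (sqsum m (fun x => P h f x - f x)%R <= e%:E)%E.
Proof.
case: hP => _ P0 _ cv fl2 e e0.
have [d d0 hd] := cvg_right0_le (cv _ fl2) e0; exists d => // h /andP[].
rewrite le_eqVlt => /orP[/eqP <- _|h0 hlt].
  rewrite P0//; apply/sqsum_leP => F; rewrite big1 ?ltW// => x _.
  by rewrite subrr expr0n mulr0.
by have := hd h h0 hlt; rewrite l2norm_sqE.
Qed.

(** Uniform boundedness principle: otherwise nested balls shrink to some [y] for
which [P h y] is unbounded along times [h] tending to 0, against strong
continuity at 0. *)
Lemma C0_locally_bounded : exists d M, [/\ 0 < d, 0 <= M & bound_on d M].
Proof.
apply: contrapT => nb.
have unb d M : 0 < d -> 0 <= M -> ~ bound_on d M.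
  by move=> d0 M0 b; apply: nb; exists d, M.
(* States are triples made of a step number, a centre and a squared radius. *)
pose Q (p q : nat * (X -> R) * R) := let: (n, x, r) := p in
  0 < r -> in_l2 m x -> let: (n', x', r') := q in
  n' = n.+1 /\ exists h : R,
  [/\ in_l2 m x', 0 < r' <= r / 16, 0 <= h <= n.+1%:R^-1,
     (sqsum m (fun z => x' z - x z)%R <= r%:E)%E &
     forall y, (sqsum m (fun z => y z - x' z)%R <= (4 * r')%:E)%E ->
       ~ (sqsum m (P h y) <= n%:R%:E)%E].
have Qex p : exists q, Q p q.
  case: p => [[n x] r] /=.
  have [[r0 xl2]|no] := pselect (0 < r /\ in_l2 m x).
    have [x' [r' [h H]]] := shrinking_ball_step n unb r0 xl2.
    by exists (n.+1, x', r') => _ _; split => //; exists h.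
  by exists (n, x, r) => r0 xl2; exfalso; apply: no.
have [nx hnx] := choice Qex.
pose st k := iter k nx (0%N, (fun _ => 0) : X -> R, 1).
pose xs k := (st k).1.2; pose rs k := (st k).2.
have st_ok k : [/\ (st k).1.1 = k, 0 < rs k & in_l2 m (xs k)].
  elim: k => [|k [IH1 IH2 IH3]].
    split => //; apply: (@in_l2_le _ 0); apply/sqsum_leP => F.
    by rewrite big1// => x _; rewrite expr0n mulr0.
  have := hnx (st k); rewrite /rs /xs /st iterS -/(st k).
  move: IH1 IH2 IH3; rewrite /rs /xs.
  case: (st k) => [[n x] r] /= -> r0 xl2.
  case: (nx _) => [[n' x'] r'] /= /(_ r0 xl2) [-> [h [? /andP[? _] _ _ _]]].
  by split.
have step k : exists h : R, [/\ 0 < rs k.+1 <= rs k / 16, 0 <= h <= k.+1%:R^-1,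
     (sqsum m (fun z => xs k.+1 z - xs k z)%R <= (rs k)%:E)%E &
     forall y, (sqsum m (fun z => y z - xs k.+1 z)%R <= (4 * rs k.+1)%:E)%E ->
       ~ (sqsum m (P h y) <= k%:R%:E)%E].
  have := hnx (st k); have [] := st_ok k; rewrite /rs /xs /st iterS -/(st k).
  case: (st k) => [[n x] r] /= -> r0 xl2.
  case: (nx _) => [[n' x'] r'] /= /(_ r0 xl2) [_ [h [? ? ? ? ?]]].
  by exists h.
have ball_in k j : (sqsum m (fun z => xs (k + j)%N z - xs k z)%R <= (4 * rs
  k)%:E)%E.
  elim: j k => [|j IH] k.
    apply/sqsum_leP => F; rewrite big1 ?mulr_ge0//;
      first by case: (st_ok k) => _ /ltW.
    by move=> x _; rewrite addn0 subrr expr0n mulr0.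
  have [h [/andP[_ rk] _ xk _]] := step k.
  have := sqsumD m0 (IH k.+1) xk; rewrite addSnnS.
  rewrite (_ : (fun i => _) = fun z => xs (k + j.+1)%N z - xs k z); last first.
    by apply/funext => z; rewrite addrA subrK.
  by move/le_trans; apply; rewrite lee_fin; have [_ ? _] := st_ok k; lra.
have rs_small k : rs k <= k.+1%:R^-1.
  elim: k => [|k IH]; first by rewrite invr1.
  have [h [/andP[_ rk] _ _ _]] := step k.
  rewrite (le_trans rk)// ler_pdivrMr//.
  have k1 : 0 < k.+1%:R :> R by []. have k2 : 0 < k.+2%:R :> R by [].
  rewrite (le_trans IH)// -[leRHS]mulrC ler_pdivlMr// mulrC ler_pdivrMr//.
  by rewrite -natrM ler_nat; lia.
have [y hy] : exists y : X -> R, forall z, xs k z @[k --> \oo] --> y z.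
  suff cv z : cvgn (xs ^~ z) by exists (fun z => limn (xs ^~ z)).
  apply: cauchy_cvg; apply: cauchy_exP => e e0; pose c := e ^+ 2 * m z / 5.
  have c0 : 0 < c by rewrite divr_gt0 ?mulr_gt0// exprn_gt0.
  have [k kc] : exists k, k.+1%:R^-1 < c.
    exists (Num.truncn c^-1).
    by rewrite invf_plt ?posrE// truncnS_gt.
  exists (xs k z); exists k => //= j /= kj.
  rewrite -ball_normE /ball_ /= distrC -(subnKC kj).
  have := sqsum_pt z (ball_in k (j - k)%N); set D := xs _ z - _ => hD.
  rewrite -(@ltr_pXn2r _ 2)// ?nnegrE ?ltW// real_normK ?num_real//.
  rewrite -(ltr_pM2l (hm z)); have := rs_small k; move: kc hD; rewrite /c.
  have : 0 < m z * e ^+ 2 by rewrite mulr_gt0// exprn_gt0.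
  rewrite [e ^+ 2 * _]mulrC; move: (m z * D ^+ 2) (m z * e ^+ 2) => a b.
  by move: (k.+1%:R^-1) (rs k) => u v; lra.
have y_ball k : (sqsum m (fun z => y z - xs k z)%R <= (4 * rs k)%:E)%E.
  apply: (@sqsum_cvg _ _ _ (fun j z => xs j z - xs k z)).
    by move=> z; apply: cvgB; [exact: hy|exact: cvg_cst].
  by exists k => // j /= kj; rewrite -(subnKC kj).
have yl2 : in_l2 m y.
  have [_ _ x0l2] := st_ok 0%N; have := in_l2D (in_l2_le (y_ball 0%N)) x0l2.
  by congr in_l2; apply/funext => z; rewrite subrK.
have [d d0 hd] := C0_near0 yl2 ltr01.
have [Y hY] := (in_l2P y).1 yl2.
have [k [kd kY]] : exists k : nat, k.+1%:R^-1 < d /\ 2 * (1 + Y) <= k%:R.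
  exists (Num.truncn d^-1 + Num.truncn (2 * (1 + Y))).+1; split.
    rewrite invf_plt ?posrE// (lt_le_trans (truncnS_gt _))//.
    by rewrite ler_nat ltnS; exact: leqW (leq_addr _ _).
  by rewrite (le_trans (ltW (truncnS_gt _)))// ler_nat ltnS leq_addl.
have [h [_ /andP[h0 hk] _ /(_ y (y_ball k.+1)) nP]] := step k.
apply: nP; have := hd h; rewrite h0 (le_lt_trans hk)// => /(_ isT) hh.
have := sqsumD m0 hh hY.
rewrite (_ : (fun i => _) = P h y); last by apply/funext => z; rewrite subrK.
by move/le_trans; apply; rewrite lee_fin.
Qed.

Lemma C0_bound_on t : exists2 M, 0 <= M & bound_on t M.
Proof.
have [d [M [d0 M0 hM]]] := C0_locally_bounded.
have : exists n : nat, t <= n%:R * d.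
  exists (Num.truncn (t / d)).+1; rewrite -ler_pdivrMr//.
  exact: ltW (truncnS_gt _).
move=> [n]; elim: n t => [|n IH] t.
  rewrite mul0r => t0; exists M => // h f c /andP[h0 ht] fc.
  by apply: hM => //; rewrite h0 (le_trans ht)// (le_trans t0)// ltW.
rewrite -natr1 mulrDl mul1r -lerBlDr => /IH[M' M'0 hM'].
exists (M + M * M'); first by rewrite addr_ge0 ?mulr_ge0.
move=> h f c /andP[h0 ht] fc.
have c0 : 0 <= c by rewrite -lee_fin (le_trans _ fc)// sqsum_ge0.
have [hd|hd] := leP h d.
  rewrite (le_trans (hM h f c _ fc)) ?h0 ?hd// lee_fin mulrDl lerDl.
  by rewrite !mulr_ge0.
case: hP => _ _ semi _.
rewrite -(subrK d h) addrC semi; [|exact: ltW| |exact: in_l2_le fc]; last first.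
  by rewrite subr_ge0 ltW.
have hd' : 0 <= h - d <= t - d by rewrite subr_ge0 (ltW hd) lerB.
rewrite (le_trans (hM _ _ _ _ (hM' _ _ _ hd' fc))) ?lexx ?(ltW d0)//.
by rewrite lee_fin mulrDl mulrA lerDr mulr_ge0.
Qed.

End LocalBound.
End L2Operators.

Section SemigroupUniqueness.
Context (R : realType) (X : countType) (m : X -> R).
Hypothesis hm : forall x, 0 < m x.
Variable P : R -> (X -> R) -> (X -> R).
Hypothesis hP : C0_semigroup m P.

Let m0 x : 0 <= m x. Proof. exact: ltW. Qed.

(** The quantitative form of [- v] being the image of [u] under the generator of
[P]; unlike the definition as a limit it is directly compatible with
differences. *)
Definition minus_generator (u v : X -> R) : Prop :=
  [/\ in_l2 m u, in_l2 m v & forall e, 0 < e -> exists2 d, 0 < d &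
   forall h, 0 < h -> h < d ->
   (sqsum m (fun x => P h u x - u x + h * v x)%R <= (e * h ^+ 2)%:E)%E].

Lemma generator_minus (u v : X -> R) :
  semigroup_generator m P u (fun x => - v x) -> minus_generator u v.
Proof.
move=> [ul2 vl2 cv]; split => //.
  have := in_l2Z hm (- 1) vl2; congr in_l2; apply/funext => x.
  by rewrite mulN1r opprK.
move=> e e0; have [d d0 hd] := cvg_right0_le cv e0; exists d => // h h0 hlt.
have := hd h h0 hlt; rewrite l2norm_sqE => /(@sqsumZ _ _ _ _ h _).
rewrite [h ^+ 2 * e]mulrC; congr (_ <= _)%E; apply: eq_esum => x _.
rewrite -[(_ - _) x]/(h^-1 * (P h u x - u x) - - v x) opprK mulrDr.
by rewrite mulVKf ?gt_eqF.
Qed.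

Lemma minus_generatorB (u v u' v' : X -> R) :
  minus_generator u v -> minus_generator u' v' ->
  minus_generator (fun x => u x - u' x) (fun x => v x - v' x).
Proof.
move=> [ul2 vl2 hu] [u'l2 v'l2 hu']; split; [exact: in_l2B..|].
move=> e e0; have e40 : 0 < e / 4 by rewrite divr_gt0.
have [d d0 hd] := hu _ e40; have [d' d'0 hd'] := hu' _ e40.
exists (Num.min d d'); first by rewrite lt_min d0.
move=> h h0; rewrite lt_min => /andP[hltd hltd'].
have := sqsumB m0 (hd h h0 hltd) (hd' h h0 hltd').
rewrite (opB (C0_bounded hP (ltW h0)) ul2 u'l2).
rewrite (_ : (fun i => P h u i - u i + h * v i - _) =
    fun x => P h u x - P h u' x - (u x - u' x) + h * (v x - v' x)); last first.
  by apply/funext => x; ring.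
by move/le_trans; apply; rewrite lee_fin; lra.
Qed.

Variables (u v : R -> X -> R) (t : R).
Hypothesis t0 : 0 <= t.
Hypothesis genu : forall s, 0 <= s <= t ->
  minus_generator (u s) (v s).
Hypothesis du : forall s, 0 <= s <= t -> forall e, 0 < e -> exists2 d, 0 < d &
  forall r, 0 <= r <= t -> `|r - s| < d ->
  (sqsum m (fun x => u r x - u s x + (r - s) * v s x)%R
     <= (e * (r - s) ^+ 2)%:E)%E.

Let forward s e : 0 <= s <= t -> 0 < e -> exists2 d, 0 < d &
  forall r, s < r <= t -> r - s < d ->
  (sqsum m (fun x => u r x - P (r - s) (u s) x)%R <= (e * (r - s) ^+ 2)%:E)%E.
Proof.
move=> hs e0; have e40 : 0 < e / 4 by rewrite divr_gt0.
have [ul2 vl2 /(_ _ e40)[d1 d10 h1]] := (genu hs).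
have [d2 d20 h2] := du hs e40.
exists (Num.min d1 d2); first by rewrite lt_min d10.
move=> r /andP[sr rt]; rewrite lt_min => /andP[rd1 rd2].
have hr : 0 <= r <= t by rewrite rt (le_trans _ (ltW sr))//; case/andP: hs.
have rs0 : 0 < r - s by rewrite subr_gt0.
have := sqsumB m0 (h2 r hr _) (h1 _ rs0 rd1).
rewrite gtr0_norm// => /(_ rd2).
rewrite (_ : (fun i => _) = fun x => u r x - P (r - s) (u s) x); last first.
  by apply/funext => x; ring.
by move/le_trans; apply; rewrite lee_fin; lra.
Qed.

Let backward s e : 0 <= s <= t -> 0 < e -> exists2 d, 0 < d &
  forall r, 0 <= r < s -> s - r < d ->
  (sqsum m (fun x => u s x - P (s - r) (u r) x)%R <= (e * (s - r) ^+ 2)%:E)%E.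
Proof.
move=> hs e0; have [s0 st] := andP hs.
have [M M0 hM] := C0_bound_on hm hP t.
have M8 : 0 < 8 + 2 * M by rewrite ltr_pwDl// mulr_ge0.
(* Two applications of [sqsumD] to errors [e'], [e'] and [M * e'] produce the
   factor [8 + 2 * M]. *)
pose e' := e / (8 + 2 * M); have e'0 : 0 < e' by rewrite divr_gt0.
have [ul2 vl2 /(_ _ e'0)[d1 d10 h1]] := (genu hs).
have [d2 d20 h2] := du hs e'0.
have [d3 d30 h3] := C0_near0 hP vl2 e'0.
exists (Num.min d1 (Num.min d2 d3)); first by rewrite !lt_min d10 d20.
move=> r /andP[r0 rs]; rewrite !lt_min => /and3P[rd1 rd2 rd3].
have hr : 0 <= r <= t by rewrite r0 (le_trans (ltW rs)).
have [url2 _ _] := (genu hr).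
have := h2 r hr; rewrite distrC gtr0_norm ?subr_gt0// => /(_ rd2).
rewrite -sqrrN opprB; set h := s - r => A3.
have h0 : 0 < h by rewrite subr_gt0.
have ht : 0 <= h <= t by rewrite ltW//= (le_trans _ st)// /h gerBl.
have op := C0_bounded hP (ltW h0).
have hv : in_l2 m (fun x => h * v s x) by exact: in_l2Z.
have B1 := h1 h h0 rd1.
have h03 : 0 <= h < d3 by rewrite ltW.
have B2 := sqsumZ h (h3 h h03).
have B3 := hM _ _ _ ht A3.
have := sqsumN (sqsumD m0 (sqsumD m0 B1 B2) B3).
have -> : P h (fun x => u r x - u s x + (r - s) * v s x) =
    (fun x => P h (u r) x - P h (u s) x - h * P h (v s) x).
  have -> : (fun x => u r x - u s x + (r - s) * v s x) =
      fun x => (fun z => u r z - u s z) x - (fun z => h * v s z) x.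
    by apply/funext => x; rewrite /h /=; ring.
  by rewrite (opB op (in_l2B hm url2 ul2) hv) (opB op url2 ul2) (opZ hm op _
    vl2).
rewrite (_ : (fun i => _) = fun x => u s x - P h (u r) x); last first.
  by apply/funext => x; ring.
move/le_trans; apply; rewrite lee_fin le_eqVlt; apply/orP; left; apply/eqP.
by rewrite /e'; field; rewrite gt_eqF.
Qed.

Let K x s := P (t - s) (u s) x.

Let K_incr x M r s c : bound_on m P t M -> 0 <= r -> r <= s -> s <= t ->
  (sqsum m (fun x => u s x - P (s - r) (u r) x)%R <= c%:E)%E ->
  m x * (K x s - K x r) ^+ 2 <= M * c.
Proof.
move=> hM r0 rs st hc.
have r_in : 0 <= r <= t by rewrite r0 (le_trans rs).
have s_in : 0 <= s <= t by rewrite st (le_trans r0).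
have ts : 0 <= t - s <= t by rewrite subr_ge0 st/= gerBl (le_trans r0).
have sr : 0 <= s - r by rewrite subr_ge0.
have [ur _ _] := (genu r_in).
have [us _ _] := (genu s_in).
have ts0 : 0 <= t - s by rewrite subr_ge0.
have -> : K x s - K x r = P (t - s) (fun x => u s x - P (s - r) (u r) x) x.
  rewrite (opB (C0_bounded hP ts0))//; last exact: op_in_l2 (C0_bounded hP sr)
    _ ur.
  case: hP => _ _ semi _; rewrite -semi// /K.
  by congr (_ - P _ _ _); ring.
exact: sqsum_pt (hM _ _ _ ts hc).
Qed.

(** For a solution of [u' = - v], where [- v(s)] is the image of [u(s)] under
the generator, the curve [s |-> P (t - s) (u s)] joins [P t (u 0)] to [u t], and
its increment between [r <= s] is the image under [P (t - s)] of [u s - P (s -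
r) (u r)]. This vector is [o(s - r)] both for fixed [r] and for fixed [s], so
that each coordinate of the curve has zero derivative. *)
Lemma C0_unique : u t = P t (u 0).
Proof.
have [M M0 hM] := C0_bound_on hm hP t.
apply/funext => x.
have -> : u t x = K x t.
  have tt' : 0 <= t <= t by rewrite t0 lexx.
  have [ut _ _] := (genu tt').
  by rewrite /K subrr; case: hP => _ -> .
have -> : P t (u 0) x = K x 0 by rewrite /K subr0.
apply: flat_on_segment => // s hs e e0.
have [s0 st] := andP hs.
have M1 : 0 < M + 1 by rewrite ltr_wpDl.
pose E := m x * e ^+ 2 / (M + 1).
have E0 : 0 < E by rewrite divr_gt0// mulr_gt0// exprn_gt0.
have conclude a h : m x * a ^+ 2 <= M * (E * h ^+ 2) -> 0 <= h -> `|a| <= e * h.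
  move=> ma h0; have eh0 : 0 <= e * h by rewrite mulr_ge0// ltW.
  rewrite -(@ler_pXn2r _ 2)// real_normK ?num_real// -(ler_pM2l (hm x))
    (le_trans ma)//.
  have -> : m x * (e * h) ^+ 2 = (M + 1) * (E * h ^+ 2).
    by rewrite /E; field; rewrite gt_eqF.
  by rewrite ler_wpM2r ?lerDl// mulr_ge0 ?sqr_ge0// ltW.
have [d1 d10 h1] := forward hs E0; have [d2 d20 h2] := backward hs E0.
exists (Num.min d1 d2); first by rewrite lt_min d10.
move=> r /andP[r0 rt]; rewrite lt_min; case: (ltrgtP r s) => [rs|sr|->].
- move=> /andP[_ rd]; rewrite distrC; apply: conclude;
  last by rewrite subr_ge0 ltW.
  by apply: K_incr => //; [exact: ltW|apply: h2; rewrite // r0].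
- move=> /andP[rd _]; apply: conclude; last by rewrite subr_ge0 ltW.
  by apply: K_incr => //; [exact: ltW|apply: h1; rewrite // sr].
- by rewrite subrr normr0 mulr0.
Qed.

End SemigroupUniqueness.

(** * Heat kernels of the finite restrictions *)

Section MeanValue.
Context (R : realType).

Lemma mean_value (f df : R -> R) a b :
  (forall x, is_derive x (1 : R) f (df x)) -> a <= b ->
  exists2 c, a <= c <= b & f b - f a = df c * (b - a).
Proof.
move=> fdf ab; have cf : {within `[a, b], continuous f}.
  apply/continuous_subspaceT => x; apply: differentiable_continuous.
  exact/derivable1_diffP/(@ex_derive _ _ _ _ _ _ _ (fdf x)).
have [c] := @MVT_segment _ f df a b ab (fun x _ => fdf x) cf.
by rewrite in_itv /=; exists c.
Qed.

End MeanValue.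

Section DirichletKernel.
Context (R : realType) (X : countType) (m : X -> R) (b : X -> X -> R).
Hypothesis hm : forall x, 0 < m x.
Hypothesis hb : is_graph b.
Implicit Types (F : {fset X}) (x y z : X) (s t : R).

Let m0 x : 0 <= m x. Proof. exact: ltW. Qed.
Let mn0 x : m x != 0. Proof. by rewrite gt_eqF. Qed.

Lemma b_ge0 x y : 0 <= b x y. Proof. by case: hb. Qed.
Lemma b_sym x y : b x y = b y x. Proof. by case: hb. Qed.

Definition deg x : R := fine (\esum_(y in [set: X]) (b x y)%:E).

Lemma degE x : \esum_(y in [set: X]) (b x y)%:E = (deg x)%:E.
Proof.
rewrite /deg fineK// ge0_fin_numE; first by case: hb.
by apply: esum_ge0 => y _; rewrite lee_fin b_ge0.
Qed.

Lemma sum_le_deg F x : \sum_(y <- F) b x y <= deg x.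
Proof. by rewrite -lee_fin -degE sum_le_esum. Qed.

Lemma deg_ge0 x : 0 <= deg x.
Proof. by have := sum_le_deg fset0 x; rewrite big_seq_fset0. Qed.

(** Minus the Dirichlet Laplacian: the diagonal contains the full degree,
including the edges that leave the finite set on which the kernel is restricted.
*)
Definition dirichlet_gen x y : R := (b x y - deg x * (x == y)%:R) / m x.

(** Minus the Neumann Laplacian of [F]: only the edges inside [F] are counted.
*)
Definition neumann_gen F x y : R :=
  (b x y - (\sum_(z <- F) b x z) * (x == y)%:R) / m x.

(** The heat kernel of the Dirichlet restriction to [F], extended by 0. *)
Definition dker F t x y : R :=
  if x \in F then kexp F dirichlet_gen t x y else 0.

(** The heat kernel of the Neumann restriction to [F], extended by 0. *)
Definition nker F t x y : R :=
  if x \in F then kexp F (neumann_gen F) t x y else 0.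

Lemma gen_off c x y : x != y -> 0 <= (b x y - c * (x == y)%:R) / m x.
Proof.
by move=> /negPf ->; rewrite mulr0 subr0 divr_ge0 ?b_ge0.
Qed.

Lemma kpow_out F (a : X -> X -> R) n x y : y \notin F -> x \in F ->
  kpow F a n x y = 0.
Proof.
move=> yF; elim: n x => [|n IH] x xF.
  by rewrite /kpow /=; case: eqP => // xy; rewrite -xy xF in yF.
by rewrite kpowS big_seq big1// => z zF; rewrite IH ?mulr0.
Qed.

Lemma kexp_out F (a : X -> X -> R) t x y : y \notin F -> x \in F ->
  kexp F a t x y = 0.
Proof.
move=> yF xF; rewrite /kexp -[RHS](egf_cst0 t); congr egf.
by apply/funext => n; rewrite kpow_out.
Qed.

Lemma dker_outr F t x y : y \notin F -> dker F t x y = 0.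
Proof. by rewrite /dker; case: ifP => // xF yF; rewrite kexp_out. Qed.

Lemma dker_outl F t x y : x \notin F -> dker F t x y = 0.
Proof. by rewrite /dker => /negPf ->. Qed.

Lemma nker_outr F t x y : y \notin F -> nker F t x y = 0.
Proof. by rewrite /nker; case: ifP => // xF yF; rewrite kexp_out. Qed.

Lemma nker_outl F t x y : x \notin F -> nker F t x y = 0.
Proof. by rewrite /nker => /negPf ->. Qed.

Lemma dker0 F x y : x \in F -> dker F 0 x y = (x == y)%:R.
Proof. by rewrite /dker => ->; rewrite kexp0. Qed.

(** This is domain monotonicity: the off-diagonal entries of the generator are
nonnegative. *)
Lemma dker_mono F F' t x y : (F `<=` F')%fset -> 0 <= t ->
  0 <= dker F t x y <= dker F' t x y.
Proof.
move=> FF' t0.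
have off z w : z != w -> 0 <= dirichlet_gen z w by exact: gen_off.
have pos (G : {fset X}) : 0 <= dker G t x y.
  have [yG|yG] := boolP (y \in G); last by rewrite dker_outr.
  rewrite /dker; case: ifP => // xG.
  have := @kexp_le _ _ G G dirichlet_gen dirichlet_gen t x y (fsubset_refl G).
  by move=> /(_ _ _ _ t0 xG yG)/andP[]//; move=> *; exact: off.
have [xF|xF] := boolP (x \in F); last by rewrite (dker_outl t y xF) lexx pos.
have [yF|yF] := boolP (y \in F); last by rewrite (dker_outr t x yF) lexx pos.
rewrite /dker xF (fsubsetP FF' x xF).
by apply: kexp_le => // *; exact: off.
Qed.

Lemma dker_ge0 F t x y : 0 <= t -> 0 <= dker F t x y.
Proof. by move=> t0; have /andP[] := dker_mono x y (fsubset_refl F) t0. Qed.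

(** Removing the killing caused by the edges that leave [F] increases the
exponential. *)
Lemma dker_le_nker F t x y : 0 <= t -> dker F t x y <= nker F t x y.
Proof.
move=> t0.
have [xF|xF] := boolP (x \in F); last by rewrite dker_outl ?nker_outl.
have [yF|yF] := boolP (y \in F); last by rewrite dker_outr ?nker_outr.
rewrite /dker /nker xF.
have := @kexp_le _ _ F F dirichlet_gen (neumann_gen F) t x y (fsubset_refl F).
move=> /(_ _ _ _ t0 xF yF)/andP[]//.
- by move=> *; exact: gen_off.
- by move=> *; exact: gen_off.
- move=> z w _ _; rewrite ler_wpM2r ?invr_ge0// lerB// ler_wpM2r//.
  exact: sum_le_deg.
Qed.

Lemma dker_sym F t x y : m x * dker F t x y = m y * dker F t y x.
Proof.
have [xF|xF] := boolP (x \in F); last first.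
  by rewrite (dker_outl _ _ xF) (dker_outr _ _ xF) !mulr0.
have [yF|yF] := boolP (y \in F); last first.
  by rewrite (dker_outl _ _ yF) (dker_outr _ _ yF) !mulr0.
rewrite /dker xF yF; apply: kexp_sym => // z w _ _.
rewrite /dirichlet_gen !(mulrC (m _)) !divfK// b_sym eq_sym.
by case: eqP => [->|]; rewrite ?mulr0.
Qed.

Lemma nker_sym F t x y : m x * nker F t x y = m y * nker F t y x.
Proof.
have [xF|xF] := boolP (x \in F); last first.
  by rewrite (nker_outl _ _ xF) (nker_outr _ _ xF) !mulr0.
have [yF|yF] := boolP (y \in F); last first.
  by rewrite (nker_outl _ _ yF) (nker_outr _ _ yF) !mulr0.
rewrite /nker xF yF; apply: kexp_sym => // z w _ _.
rewrite /neumann_gen !(mulrC (m _)) !divfK// b_sym eq_sym.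
by case: eqP => [->|]; rewrite ?mulr0.
Qed.

(** The rows of the Neumann generator have sum 0. *)
Lemma nker_row1 F t x : x \in F -> \sum_(y <- F) nker F t x y = 1.
Proof.
move=> xF; rewrite /nker xF; apply: kexp_row1 => // z zF.
rewrite -mulr_suml sumrB.
under [X in _ - X]eq_bigr do rewrite eq_sym.
by rewrite (sum_delta (fun=> _) zF) subrr mul0r.
Qed.

Lemma dker_row F (G : {fset X}) t x : 0 <= t -> \sum_(y <- G) dker F t x y <= 1.
Proof.
move=> t0; have [xF|xF] := boolP (x \in F); last first.
  by rewrite big1// => y _; rewrite dker_outl.
rewrite -(nker_row1 t xF) (@le_trans _ _ (\sum_(y <- F) dker F t x y))//.
  rewrite -(sum_fset_supp _ (fsubsetUl F G)).
    by apply: sum_fset_le (fsubsetUr F G) => y; exact: dker_ge0.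
  by move=> y; exact: dker_outr.
by apply: ler_sum => y _; exact: dker_le_nker.
Qed.

Lemma dker_le1 F t x y : 0 <= t -> dker F t x y <= 1.
Proof. by move=> t0; have := dker_row F [fset y]%fset x t0;
  rewrite big_seq_fset1. Qed.

Lemma dkerD F s t x y :
  dker F (s + t) x y = \sum_(z <- F) dker F s x z * dker F t z y.
Proof.
rewrite {1 2}/dker; case: ifP => xF; last by rewrite big1// => z _;
  rewrite mul0r.
by rewrite kexpD//; apply: eq_big_seq => z zF; rewrite /dker zF.
Qed.

Lemma is_derive_dker F t x y : x \in F ->
  is_derive t (1 : R) (fun s => dker F s x y)
    (\sum_(z <- F) dirichlet_gen x z * dker F t z y).
Proof.
move=> xF; rewrite (_ : \sum_(z <- F) _ =
    \sum_(z <- F) dirichlet_gen x z * kexp F dirichlet_gen t z y); last first.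
  by apply: eq_big_seq => z zF; rewrite /dker zF.
rewrite /dker xF; exact: is_derive_kexp.
Qed.

(** The derivative of [dker t y y] is row [y] of the generator applied to a
column with entries in the unit interval, so it is bounded by the sum of the
absolute values in that row, uniformly in [F]. *)
Lemma dker_diag_lip F s t y : 0 <= s -> 0 <= t ->
  `|dker F t y y - dker F s y y| <= 2 * deg y / m y * `|t - s|.
Proof.
wlog st : s t / s <= t => [hw s0 t0|s0 t0].
  by have [st|/ltW st] := leP s t; [|rewrite distrC (distrC t)]; exact: hw.
have [yF|yF] := boolP (y \in F); last first.
  by rewrite !dker_outl// subrr normr0 mulr_ge0// divr_ge0// mulr_ge0// deg_ge0.
have [c /andP[sc ct] ->] := mean_value (fun r => is_derive_dker r y yF) st.
rewrite normrM ler_wpM2r// (le_trans (ler_norm_sum _ _ _))//.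
rewrite (@le_trans _ _ (\sum_(z <- F) (b y z + deg y * (z == y)%:R) / m y))//.
  apply: ler_sum => z _; rewrite normrM -[leRHS]mulr1.
  have c0 : 0 <= c by rewrite (le_trans s0).
  apply: ler_pM => //; last by rewrite ger0_norm ?dker_le1 ?dker_ge0.
  rewrite /dirichlet_gen normrM normfV (ger0_norm (m0 y)) ler_wpM2r ?invr_ge0//.
  rewrite (le_trans (ler_normB _ _))// ger0_norm ?b_ge0// lerD2l.
  by rewrite ger0_norm ?mulr_ge0 ?deg_ge0// eq_sym.
rewrite -mulr_suml ler_wpM2r ?invr_ge0// big_split/= (sum_delta (fun=> _) yF).
by rewrite mulr2n mulrDl !mul1r lerD2r sum_le_deg.
Qed.

Lemma sqsum_finsupp F (v : X -> R) : (forall x, x \notin F -> v x = 0) ->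
  sqsum m v = (\sum_(x <- F) m x * v x ^+ 2)%:E.
Proof.
move=> vF; rewrite /sqsum (esum_finsupp (F := F))//.
  by move=> x; rewrite mulr_ge0 ?sqr_ge0.
by move=> x /vF ->; rewrite expr0n mulr0.
Qed.

Lemma dker_pair F s t y :
  \sum_(x <- F) m x * (dker F s x y * dker F t x y) = m y * dker F (s + t) y y.
Proof.
rewrite dkerD mulr_sumr; apply: eq_bigr => x _.
by rewrite mulrA dker_sym mulrA.
Qed.

(** By symmetry and the semigroup law, the square norm of the increment is [m y]
times the second difference [k(2t) - 2 k(s+t) + k(2s)] of the diagonal [k(r) =
dker r y y]. The constant does not depend on [F]. *)
Lemma dker_sqlip F s t y : 0 <= s -> 0 <= t ->
  (sqsum m (fun x => dker F t x y - dker F s x y)%R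
    <= (4 * deg y * `|t - s|)%:E)%E.
Proof.
move=> s0 t0; rewrite (@sqsum_finsupp F); last first.
  by move=> x xF; rewrite !dker_outl// subrr.
rewrite lee_fin.
have -> : \sum_(x <- F) m x * (dker F t x y - dker F s x y) ^+ 2 =
    m y * ((dker F (t + t) y y - dker F (t + s) y y)
          - (dker F (s + t) y y - dker F (s + s) y y)).
  rewrite !mulrBr -!dker_pair -!sumrB; apply: eq_bigr => x _; ring.
have := dker_diag_lip F y (addr_ge0 t0 s0) (addr_ge0 t0 t0).
have := dker_diag_lip F y (addr_ge0 s0 s0) (addr_ge0 s0 t0).
set A := dker F (t + t) y y - _; set B := _ - dker F (s + s) y y.
move=> hB hA.
have : A - B <= 2 * (2 * deg y / m y * `|t - s|).
  have := ler_norm A; have := ler_norm (- B); rewrite normrN.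
  move: hB hA; rewrite (_ : s + t - (s + s) = t - s); last by ring.
  rewrite (_ : t + t - (t + s) = t - s); last by ring.
  by move: A B `|t - s| (deg y / m y) => A B d q; lra.
move=> /(ler_wpM2l (m0 y)) /le_trans; apply.
by rewrite le_eqVlt; apply/orP; left; apply/eqP; field.
Qed.

Lemma dker_sq_le F t y :
  0 <= t -> (sqsum m (fun x => dker F t x y) <= (m y)%:E)%E.
Proof.
move=> t0; rewrite (@sqsum_finsupp F); last by move=> x; exact: dker_outl.
under eq_bigr do rewrite expr2.
by rewrite lee_fin dker_pair ler_piMr// dker_le1// addr_ge0.
Qed.

End DirichletKernel.

Section IntegratedKernel.
Context (R : realType) (X : countType) (m : X -> R) (b : X -> X -> R).
Hypothesis hm : forall x, 0 < m x.
Hypothesis hb : is_graph b.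
Implicit Types (F : {fset X}) (x y z : X) (s t : R).

Let m0 x : 0 <= m x. Proof. exact: ltW. Qed.
Local Notation dker := (dker m b).
Local Notation gen := (dirichlet_gen m b).

Definition shift_seq (w : nat -> R) (n : nat) : R :=
  if n is n'.+1 then w n' else 0.

(** The time integral of [dker], as a power series: shifting the coefficients of
an exponential generating function integrates it. *)
Definition dker_int F t x y : R :=
  if x \in F then egf (shift_seq (fun n => kpow F gen n x y)) t else 0.

Let geo_shift F x y : geo_bounded (shift_seq (fun n => kpow F gen n x y)).
Proof.
have [B [C [B0 C0 h]]] := geo_bounded_kpow F gen x y.
exists (B + B * (C + 1)), (C + 1); split => [||n].
- by rewrite addr_ge0 ?mulr_ge0 ?addr_ge0.
- by rewrite addr_ge0.
have C10 : 0 <= C + 1 by rewrite addr_ge0.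
case: n => [|n] /=; first by rewrite normr0 mulr_ge0 ?addr_ge0 ?mulr_ge0//
  exprn_ge0.
rewrite (le_trans (h n))// (@le_trans _ _ (B * (C + 1) ^+ n.+1))//.
  rewrite ler_wpM2l// exprS (@le_trans _ _ (1 * (C + 1) ^+ n))//.
    by rewrite mul1r lerXn2r ?nnegrE// lerDl.
  by rewrite ler_wpM2r ?exprn_ge0// lerDr.
by rewrite ler_wpM2r ?exprn_ge0// lerDl mulr_ge0.
Qed.

Lemma is_derive_dker_int F t x y :
  is_derive t (1 : R) (fun s => dker_int F s x y) (dker F t x y).
Proof.
rewrite /dker_int /dker; case: ifP => _; last exact: is_derive_cst.
exact: (is_derive_egf t (geo_shift F x y)).
Qed.

Lemma dker_int0 F x y : dker_int F 0 x y = 0.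
Proof. by rewrite /dker_int; case: ifP => // _; rewrite egf0. Qed.

Lemma dker_int_outl F t x y : x \notin F -> dker_int F t x y = 0.
Proof. by rewrite /dker_int => /negPf ->. Qed.

Lemma dker_int_mono F F' t x y : (F `<=` F')%fset -> 0 <= t ->
  0 <= dker_int F t x y <= dker_int F' t x y.
Proof.
move=> FF' t0; apply/andP; split.
  have [c /andP[c0 _]] := mean_value (fun r => is_derive_dker_int F r x y) t0.
  rewrite dker_int0 !subr0 => ->; rewrite mulr_ge0//.
  exact: dker_ge0.
have dd r : is_derive r (1 : R) (fun s => dker_int F' s x y - dker_int F s x y)
    (dker F' r x y - dker F r x y).
  by apply: is_deriveB; exact: is_derive_dker_int.
have [c /andP[c0 _]] := mean_value dd t0.
rewrite !dker_int0 !subr0 -subr_ge0 => ->; rewrite mulr_ge0// subr_ge0.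
by have /andP[] := dker_mono hm hb x y FF' c0.
Qed.

Lemma dker_int_ge0 F t x y : 0 <= t -> 0 <= dker_int F t x y.
Proof. by move=> t0; have /andP[] := dker_int_mono x y (fsubset_refl F) t0. Qed.

Lemma dker_int_le F t x y : 0 <= t -> dker_int F t x y <= t.
Proof.
move=> t0; have [c /andP[c0 _]] := mean_value (fun r => is_derive_dker_int F r
  x y) t0.
rewrite dker_int0 !subr0 => ->; rewrite ler_piMl//.
exact: dker_le1.
Qed.

(** Integrating the heat equation in time: both sides have the same derivative
and vanish at time 0. *)
Lemma dker_int_laplacian F t x y : x \in F ->
  \sum_(z <- F) gen x z * dker_int F t z y = dker F t x y - (x == y)%:R.
Proof.
move=> xF; pose f s := \sum_(z <- F) gen x z * dker_int F s z y - dker F s x y.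
suff /(_ t 0) : forall s r, f s = f r.
  rewrite /f dker0// [X in _ = X - _]big1 => [|z _];
    last by rewrite dker_int0 mulr0.
  by rewrite sub0r => /eqP; rewrite subr_eq addrC => /eqP.
move=> s r; apply: is_derive_0_is_cst => {}r.
rewrite -(subrr (\sum_(z <- F) gen x z * dker F r z y)).
apply: is_deriveB; last exact: is_derive_dker.
apply: is_derive_bigsum => z _.
by apply: is_deriveZ; exact: is_derive_dker_int.
Qed.

(** The mean value theorem, applied to the inner product of [W(q) - W(s) - (q -
s) D(s)] with its own value [v] at [q = r], expresses the square norm of [v]
through [D(c) - D(s)] for some intermediate [c]; that difference is small by
[dker_sqlip]. *)
Lemma dker_int_sqlip F s r y : 0 <= s -> 0 <= r ->
  (sqsum m (fun x => dker_int F r x y - dker_int F s x y - (r - s) * dker F s x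
    y)%R
    <= (4 * deg b y * `|r - s| ^+ 3)%:E)%E.
Proof.
move=> s0 r0; set v := fun x => _.
have vF x : x \notin F -> v x = 0.
  by move=> xF; rewrite /v !dker_int_outl// dker_outl// mulr0 !subr0.
rewrite (sqsum_finsupp hm vF) lee_fin.
pose psi q := \sum_(x <- F) m x * v x *
  (dker_int F q x y - dker_int F s x y - (q - s) * dker F s x y).
have dpsi q : is_derive q (1 : R) psi
    (\sum_(x <- F) m x * v x * (dker F q x y - dker F s x y)).
  apply: is_derive_bigsum => x _; apply: is_deriveZ; apply: is_deriveB.
    rewrite -[X in is_derive _ _ _ X]subr0; apply: is_deriveB.
    exact: is_derive_dker_int.
  rewrite (_ : (fun q => _) = (fun q => dker F s x y * (q - s))); last first.
    by apply/funext => p; rewrite mulrC.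
  rewrite -[X in is_derive _ _ _ X]mulr1; apply: is_deriveZ.
  by rewrite -[X in is_derive _ _ _ X]subr0; apply: is_deriveB.
have psis : psi s = 0.
  by rewrite /psi big1// => x _; rewrite !subrr mul0r subr0 mulr0.
have psir : psi r = \sum_(x <- F) m x * v x ^+ 2.
  by apply: eq_bigr => x _; rewrite expr2 mulrA.
have [c [c0 cs Ec]] : exists c, [/\ 0 <= c, `|c - s| <= `|r - s| &
    psi r - psi s = (\sum_(x <- F) m x * v x * (dker F c x y - dker F s x y)) *
      (r - s)].
  have [sr|/ltW rs] := leP s r.
    have [c /andP[sc cr] E] := mean_value dpsi sr; exists c; split => //.
      exact: le_trans sc.
    by rewrite !ger0_norm ?subr_ge0// lerB.
  have [c /andP[rc cs] E] := mean_value dpsi rs; exists c; split => //.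
  - exact: le_trans rc.
  - by rewrite distrC (distrC r) !ger0_norm ?subr_ge0// lerB.
  - by rewrite -[LHS]opprB E -mulrN opprB.
rewrite -psir; move: Ec; rewrite psis subr0 => Ec.
have := dker_sqlip hm hb F y s0 c0.
rewrite (@sqsum_finsupp _ _ _ hm F); last by move=> x xF;
  rewrite !dker_outl// subrr.
rewrite lee_fin; set A := \sum_(x <- F) m x * _ => hA.
have deg0 := deg_ge0 hb y.
have hA' : A <= 4 * deg b y * `|r - s|.
  by rewrite (le_trans hA)// ler_wpM2l// mulr_ge0.
have : psi r <= 2^-1 * psi r + 2^-1 * ((r - s) ^+ 2 * A).
  rewrite [leLHS]Ec psir mulr_suml mulr_sumr /A !mulr_sumr -big_split/=.
  apply: ler_sum => x _; set d := dker F c x y - _.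
  rewrite -subr_ge0 (_ : _ - _ = 2^-1 * (m x * (v x - (r - s) * d) ^+ 2)).
    by rewrite mulr_ge0// mulr_ge0// sqr_ge0.
  by field.
have : (r - s) ^+ 2 * A <= 4 * deg b y * `|r - s| ^+ 3.
  have -> : `|r - s| ^+ 3 = (r - s) ^+ 2 * `|r - s|.
    by rewrite -(real_normK (num_real (r - s))) -exprSr.
  by rewrite mulrCA ler_wpM2l ?sqr_ge0.
by move: (psi r) ((r - s) ^+ 2 * A) (4 * deg b y * `|r - s| ^+ 3) => p q u; lra.
Qed.

End IntegratedKernel.

(** * The minimal heat kernel and its time integral *)

Section MinimalKernel.
Context (R : realType) (X : countType) (m : X -> R) (b : X -> X -> R).
Hypothesis hm : forall x, 0 < m x.
Hypothesis hb : is_graph b.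
Variable Xk : nat -> {fset X}.
Hypothesis Xk_incr : forall k, (Xk k `<=` Xk k.+1)%fset.
Hypothesis Xk_cover : forall x, exists k, x \in Xk k.
Implicit Types (F : {fset X}) (x y z : X) (s t : R).

Let m0 x : 0 <= m x. Proof. exact: ltW. Qed.
Local Notation dker := (dker m b).
Local Notation dker_int := (dker_int m b).
Local Notation gen := (dirichlet_gen m b).

Lemma Xk_sub k j : (k <= j)%N -> (Xk k `<=` Xk j)%fset.
Proof.
move=> /subnKC <-; elim: (j - k)%N => [|n IH]; first by rewrite addn0.
by rewrite addnS (fsubset_trans IH).
Qed.

Lemma Xk_eventually F : \forall k \near \oo, (F `<=` Xk k)%fset.
Proof.
have key (r : seq X) : exists K : nat, forall x, x \in r -> x \in Xk K.
  elim: r => [|x r [K hK]]; first by exists 0%N.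
  have [k xk] := Xk_cover x; exists (maxn k K) => z.
  rewrite inE => /orP[/eqP ->|/hK].
    exact: (fsubsetP (Xk_sub (leq_maxl k K))).
  exact: (fsubsetP (Xk_sub (leq_maxr k K))).
have [K hK] := key F; exists K => // k /= Kk; apply/fsubsetP => x /hK.
exact: (fsubsetP (Xk_sub Kk)).
Qed.

(** The minimal heat kernel, as the increasing limit of the Dirichlet kernels of
the exhaustion. *)
Definition minker t x y : R := limn (fun k => dker (Xk k) t x y).
Definition minker_int t x y : R := limn (fun k => dker_int (Xk k) t x y).
Local Notation S := minker.
Local Notation W := minker_int.

Let dker_incr t x y : 0 <= t ->
  {homo (fun k => dker (Xk k) t x y) : k j / (k <= j)%N >-> k <= j}.
Proof.
by move=> t0 k j kj; have /andP[] := dker_mono hm hb x y (Xk_sub kj) t0.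
Qed.

Let dker_int_incr t x y : 0 <= t ->
  {homo (fun k => dker_int (Xk k) t x y) : k j / (k <= j)%N >-> k <= j}.
Proof.
by move=> t0 k j kj; have /andP[] := dker_int_mono hm hb x y (Xk_sub kj) t0.
Qed.

Lemma cvg_minker t x y : 0 <= t -> dker (Xk k) t x y @[k --> \oo] --> S t x y.
Proof.
move=> t0; apply: nondecreasing_is_cvgn; first exact: dker_incr.
by exists 1 => _ [k _ <-]; exact: dker_le1.
Qed.

Lemma cvg_minker_int t x y : 0 <= t ->
  dker_int (Xk k) t x y @[k --> \oo] --> W t x y.
Proof.
move=> t0; apply: nondecreasing_is_cvgn; first exact: dker_int_incr.
by exists t => _ [k _ <-]; exact: dker_int_le.
Qed.

Lemma dker_le_minker k t x y : 0 <= t -> dker (Xk k) t x y <= S t x y.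
Proof.
by move=> t0; exact: (nondecreasing_cvgn_le (@dker_incr t x y t0)
  (@cvg_minker t x y t0) k).
Qed.

Lemma dker_int_le_minker_int k t x y :
  0 <= t -> dker_int (Xk k) t x y <= W t x y.
Proof.
by move=> t0; exact: (nondecreasing_cvgn_le (@dker_int_incr t x y t0)
  (@cvg_minker_int t x y t0) k).
Qed.

Lemma minker_ge0 t x y : 0 <= t -> 0 <= S t x y.
Proof.
by move=> t0; rewrite (le_trans _ (dker_le_minker 0%N x y t0))// dker_ge0.
Qed.

Lemma minker0 x y : S 0 x y = (x == y)%:R.
Proof.
apply: cvg_lim => //; apply: cvg_near_cst.
by apply: filterS (Xk_eventually [fset x]%fset) => k; rewrite fsub1set;
  exact: dker0.
Qed.

Lemma minker_int0 x y : W 0 x y = 0.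
Proof.
apply: cvg_lim => //; apply: cvg_near_cst.
by apply: nearW => k; exact: dker_int0.
Qed.

Lemma minker_sym t x y : 0 <= t -> m x * S t x y = m y * S t y x.
Proof.
move=> t0.
have c1 : m x * dker (Xk k) t x y @[k --> \oo] --> m x * S t x y.
  by apply: cvgM; [exact: cvg_cst|exact: cvg_minker].
have c2 : m y * dker (Xk k) t y x @[k --> \oo] --> m y * S t y x.
  by apply: cvgM; [exact: cvg_cst|exact: cvg_minker].
have E k : m x * dker (Xk k) t x y = m y * dker (Xk k) t y x by exact: dker_sym.
by move: c1; rewrite (eq_cvg _ _ E) => c1; exact: (cvg_unique _ c1 c2).
Qed.

Lemma minker_row t x : 0 <= t ->
  (\esum_(y in [set: X]) (S t x y)%:E <= 1%:E)%E.
Proof.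
move=> t0; apply/esum_leP => F.
apply: (@cvg_le _ (fun k => \sum_(y <- F) dker (Xk k) t x y)).
  by apply: cvg_bigsum => y _; exact: cvg_minker.
by apply: nearW => k; exact: dker_row.
Qed.

Lemma minker_sq_le t y : 0 <= t -> (sqsum m (fun x => S t x y) <= (m y)%:E)%E.
Proof.
move=> t0; apply: (@sqsum_cvg _ _ _ (fun k x => dker (Xk k) t x y)).
  by move=> x; exact: cvg_minker.
by apply: nearW => k; exact: dker_sq_le.
Qed.

(** Differentiability in l2 of the time integral, with derivative the minimal
kernel: the remainder has norm of order [|r - s|^(3/2)]. *)
Lemma minker_int_sqlip s r y : 0 <= s -> 0 <= r ->
  (sqsum m (fun x => W r x y - W s x y - (r - s) * S s x y)%R
    <= (4 * deg b y * `|r - s| ^+ 3)%:E)%E.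
Proof.
move=> s0 r0.
apply: (@sqsum_cvg _ _ _ (fun k x => dker_int (Xk k) r x y - dker_int (Xk k) s
  x y -
    (r - s) * dker (Xk k) s x y)).
  move=> x; apply: cvgB; first by apply: cvgB; exact: cvg_minker_int.
  by apply: cvgM; [exact: cvg_cst|exact: cvg_minker].
by apply: nearW => k; exact: dker_int_sqlip.
Qed.

Lemma in_l2_minker t y : 0 <= t -> in_l2 m (fun x => S t x y).
Proof. by move=> t0; apply: (in_l2_le hm); exact: minker_sq_le. Qed.

Lemma in_l2_minker_int t y : 0 <= t -> in_l2 m (fun x => W t x y).
Proof.
move=> t0.
have h1 := in_l2_le hm (minker_int_sqlip y (lexx 0) t0).
have h2 := in_l2Z hm t (in_l2_minker y (lexx 0)).
have := in_l2D hm h1 h2; congr in_l2; apply/funext => x.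
by rewrite minker_int0 !subr0 subrK.
Qed.

End MinimalKernel.

(** * Green's formula and the Dirichlet Laplacian *)

Section Green.
Context (R : realType) (X : countType) (m : X -> R) (b : X -> X -> R).
Hypothesis hm : forall x, 0 < m x.
Hypothesis hb : is_graph b.
Implicit Types (F : {fset X}) (x y z : X) (f g c : X -> R).

Let m0 x : 0 <= m x. Proof. exact: ltW. Qed.
Local Notation gen := (dirichlet_gen m b).

Definition edge_weight (e : X * X) : R := b e.1 e.2.
Definition grad f (e : X * X) : R := f e.1 - f e.2.

Lemma edge_weight_ge0 e : 0 <= edge_weight e. Proof. exact: b_ge0. Qed.

Lemma energyE f : energy b f = (2^-1%:E * sqsum edge_weight (grad f))%E.
Proof. by []. Qed.

Lemma energy_formE f g :
  energy_form b f g = 2^-1 * wdot edge_weight (grad f) (grad g).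
Proof. by []. Qed.

Lemma l2innerE f g : l2inner m f g = wdot m f g.
Proof. by apply: eq_rsum => x; rewrite mulrC mulrA. Qed.

Lemma esum_pair (a : X -> X -> R) : (forall x y, 0 <= a x y) ->
  \esum_(e in [set: X * X]) (a e.1 e.2)%:E =
  \esum_(x in [set: X]) \esum_(y in [set: X]) (a x y)%:E.
Proof.
move=> a0; rewrite esum_esum; last by move=> x y _ _; rewrite lee_fin.
by congr (esum _ _); apply/seteqP; split.
Qed.

Let absum_esum (I : choiceType) (a : I -> R) (r : R) : (forall i, 0 <= a i) ->
  \esum_(i in [set: I]) (a i)%:E = r%:E -> absum a /\ rsum a = r.
Proof.
move=> a0 ac; split; last by rewrite rsum_ge0// ac.
exists r; apply/esum_leP; rewrite -ac.
by under eq_esum do rewrite ger0_norm//.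
Qed.

Lemma rsum_edges_fst x :
  absum (fun e : X * X => b x e.2 * (e.1 == x)%:R) /\
  rsum (fun e : X * X => b x e.2 * (e.1 == x)%:R) = deg b x.
Proof.
have bge0 := b_ge0 hb; apply: absum_esum => [e|]; first by rewrite mulr_ge0.
rewrite (esum_pair (a := fun p q => b x q * (p == x)%:R)); last first.
  by move=> p q; rewrite mulr_ge0.
rewrite (eq_esum (b := fun p => (deg b x * (p == x)%:R)%:E)).
  rewrite (esum_finsupp (F := [fset x]%fset)) ?big_seq_fset1 ?eqxx ?mulr1//.
    by move=> p; rewrite mulr_ge0 ?deg_ge0.
  by move=> p; rewrite inE => /negPf ->; rewrite mulr0.
move=> p _; case: eqP => _; last by rewrite mulr0 esum1// => q _; rewrite mulr0.
by under eq_esum do rewrite mulr1; rewrite mulr1 degE.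
Qed.

Lemma rsum_edges_snd x :
  absum (fun e : X * X => b x e.1 * (e.2 == x)%:R) /\
  rsum (fun e : X * X => b x e.1 * (e.2 == x)%:R) = deg b x.
Proof.
have bge0 := b_ge0 hb; apply: absum_esum => [e|]; first by rewrite mulr_ge0.
rewrite (esum_pair (a := fun p q => b x p * (q == x)%:R)); last first.
  by move=> p q; rewrite mulr_ge0.
rewrite (eq_esum (b := fun p => (b x p)%:E)) ?degE// => p _.
rewrite (esum_finsupp (F := [fset x]%fset)) ?big_seq_fset1 ?eqxx ?mulr1//.
  by move=> q; rewrite mulr_ge0.
by move=> q; rewrite inE => /negPf ->; rewrite mulr0.
Qed.

Section FiniteSupport.
Variable F : {fset X}.

Let expand c : (forall x, x \notin F -> c x = 0) ->
  forall p, c p = \sum_(x <- F) c x * (p == x)%:R.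
Proof.
move=> cF p; have [pF|pF] := boolP (p \in F).
  by under eq_bigr do rewrite eq_sym; rewrite sum_delta.
rewrite cF// big_seq big1// => x xF.
case: (p =P x) => [px|_]; last by rewrite mulr0.
by move: pF; rewrite px xF.
Qed.

Lemma rsum_deg_fst c : (forall x, x \notin F -> c x = 0) ->
  absum (fun e : X * X => b e.1 e.2 * c e.1) /\
  rsum (fun e : X * X => b e.1 e.2 * c e.1) = \sum_(x <- F) c x * deg b x.
Proof.
move=> cF.
have -> : (fun e : X * X => b e.1 e.2 * c e.1) =
    fun e => \sum_(x <- F) c x * (b x e.2 * (e.1 == x)%:R).
  apply/funext => e; rewrite (expand cF) mulr_sumr; apply: eq_bigr => x _.
  by case: eqP => [->|_]; rewrite ?mulr0//; ring.
have hx x := rsum_edges_fst x.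
have [h1 h2] := @rsum_sum _ _ X F _ (fun x => absumZ (c x) (hx x).1).
by split => //; rewrite h2; apply: eq_bigr => x _; rewrite rsumZ ?(hx x).2//;
  case: (hx x).
Qed.

Lemma rsum_deg_snd c : (forall x, x \notin F -> c x = 0) ->
  absum (fun e : X * X => b e.1 e.2 * c e.2) /\
  rsum (fun e : X * X => b e.1 e.2 * c e.2) = \sum_(x <- F) c x * deg b x.
Proof.
move=> cF.
have -> : (fun e : X * X => b e.1 e.2 * c e.2) =
    fun e => \sum_(x <- F) c x * (b x e.1 * (e.2 == x)%:R).
  apply/funext => e; rewrite (expand cF) mulr_sumr; apply: eq_bigr => x _.
  by case: eqP => [->|_]; rewrite ?mulr0// (b_sym hb e.1); ring.
have hx x := rsum_edges_snd x.
have [h1 h2] := @rsum_sum _ _ X F _ (fun x => absumZ (c x) (hx x).1).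
by split => //; rewrite h2; apply: eq_bigr => x _; rewrite rsumZ ?(hx x).2//;
  case: (hx x).
Qed.

Lemma rsum_cross f g : (forall x, x \notin F -> f x = 0) ->
  (forall x, x \notin F -> g x = 0) ->
  absum (fun e : X * X => b e.1 e.2 * (f e.1 * g e.2)) /\
  rsum (fun e : X * X => b e.1 e.2 * (f e.1 * g e.2)) =
    \sum_(x <- F) \sum_(y <- F) b x y * f x * g y.
Proof.
move=> fF gF.
have -> : (fun e : X * X => b e.1 e.2 * (f e.1 * g e.2)) =
    fun e => \sum_(x <- F) \sum_(y <- F) b x y * f x * g y * (e == (x, y))%:R.
  apply/funext => e; rewrite (expand fF) (expand gF) mulr_suml mulr_sumr.
  apply: eq_bigr => x _; rewrite !mulr_sumr; apply: eq_bigr => y _.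
  case: e => p q; rewrite xpair_eqE /=.
  case: (p =P x) => [->|_]; case: (q =P y) => [->|_] /=;
    by rewrite ?mulr0 ?mul0r ?mulr1 ?mulr0// mulrA.
have hxy x y : absum (fun e : X * X => b x y * f x * g y * (e == (x, y))%:R) /\
    rsum (fun e : X * X => b x y * f x * g y * (e == (x, y))%:R) =
      b x y * f x * g y.
  have supp (e : X * X) : e \notin [fset (x, y)]%fset ->
      b x y * f x * g y * (e == (x, y))%:R = 0.
    by rewrite inE => /negPf ->; rewrite mulr0.
  split; first exact: absum_finsupp supp.
  by rewrite (rsum_finsupp supp) big_seq_fset1 eqxx mulr1.
have hx x := @rsum_sum _ _ X F _ (fun y => (hxy x y).1).
have [h1 h2] := @rsum_sum _ _ X F _ (fun x => (hx x).1).
split => //; rewrite h2; apply: eq_bigr => x _; rewrite (hx x).2.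
by apply: eq_bigr => y _; rewrite (hxy x y).2.
Qed.

Lemma finite_energy f : (forall x, x \notin F -> f x = 0) ->
  (sqsum edge_weight (grad f) < +oo)%E.
Proof.
move=> fF; have f2F x : x \notin F -> f x ^+ 2 = 0.
  by move=> /fF ->; rewrite expr0n.
have [h1 _] := rsum_deg_fst f2F; have [h2 _] := rsum_deg_snd f2F.
have [c hc] := absumZ 2 (absumD h1 h2).
rewrite (@le_lt_trans _ _ c%:E) ?ltry//; apply/sqsum_leP => G.
rewrite (le_trans _ (hc G))//; apply: ler_sum => -[p q] _.
rewrite (le_trans _ (ler_norm _))// /edge_weight /grad /= -subr_ge0.
rewrite (_ : _ - _ = b p q * (f p + f q) ^+ 2); last by ring.
by rewrite mulr_ge0 ?sqr_ge0 ?b_ge0.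
Qed.

(** Expanding the product of differences gives two diagonal sums, each weighted
by the degrees, minus two cross sums over pairs in [F]. *)
Lemma green f g : (forall x, x \notin F -> f x = 0) ->
  (forall x, x \notin F -> g x = 0) ->
  energy_form b f g = - \sum_(x <- F) m x * g x * \sum_(z <- F) gen x z * f z.
Proof.
move=> fF gF.
have fgF x : x \notin F -> f x * g x = 0 by move=> /fF ->; rewrite mul0r.
have [a1 r1] := rsum_deg_fst fgF; have [a2 r2] := rsum_deg_snd fgF.
have [a3 r3] := rsum_cross fF gF; have [a4 r4] := rsum_cross gF fF.
rewrite energy_formE /wdot.
rewrite (@eq_rsum _ _ _ (fun e => b e.1 e.2 * (f e.1 * g e.1) +
    b e.1 e.2 * (f e.2 * g e.2) - (b e.1 e.2 * (f e.1 * g e.2) +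
    b e.1 e.2 * (g e.1 * f e.2)))); last first.
  by move=> [p q]; rewrite /edge_weight /grad /=; ring.
rewrite rsumB; [|exact: absumD..]; rewrite !rsumD// r1 r2 r3 r4.
have -> : \sum_(x <- F) \sum_(y <- F) b x y * f x * g y =
    \sum_(x <- F) \sum_(y <- F) b x y * g x * f y.
  rewrite exchange_big; apply: eq_bigr => x _; apply: eq_bigr => y _.
  by rewrite b_sym//; ring.
set A := \sum_(x <- F) _ * deg b x; set B := \sum_(x <- F) \sum_(y <- F) _.
rewrite (_ : 2^-1 * _ = A - B); last by field.
rewrite /A /B -sumrB -sumrN; apply: eq_big_seq => x xF.
have -> : m x * g x * (\sum_(i <- F) gen x i * f i) =
    \sum_(y <- F) b x y * g x * f y - f x * g x * deg b x; last by ring.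
rewrite -(sum_delta (fun z => f z * g x * deg b x) xF) -sumrB mulr_sumr.
apply: eq_bigr => z _; rewrite /dirichlet_gen eq_sym; field.
by rewrite gt_eqF.
Qed.

End FiniteSupport.
End Green.

Section IntegratedKernelDomain.
Context (R : realType) (X : countType) (m : X -> R) (b : X -> X -> R).
Hypothesis hm : forall x, 0 < m x.
Hypothesis hb : is_graph b.
Variable Xk : nat -> {fset X}.
Hypothesis Xk_incr : forall k, (Xk k `<=` Xk k.+1)%fset.
Hypothesis Xk_cover : forall x, exists k, x \in Xk k.
Variables (s : R) (y : X).
Hypothesis s0 : 0 <= s.

Let m0 x : 0 <= m x. Proof. exact: ltW. Qed.
Let ew0 := edge_weight_ge0 hb.
Local Notation ew := (edge_weight b).

Let u k x := dker_int m b (Xk k) s x y.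
Let D k x := dker m b (Xk k) s x y.
Let W x := minker_int m b Xk s x y.
Let S x := minker m b Xk s x y.
Let delta x : R := (x == y)%:R.
Let rho x := delta x - S x.

Let u_out k x : x \notin Xk k -> u k x = 0. Proof. exact: dker_int_outl. Qed.
Let u_mono k j x : (k <= j)%N -> 0 <= u k x <= u j x.
Proof. by move=> kj; apply: dker_int_mono => //; exact: Xk_sub. Qed.

Let D_mono k j x : (k <= j)%N -> 0 <= D k x <= D j x.
Proof. by move=> kj; apply: dker_mono => //; exact: Xk_sub. Qed.

Let delta_l2 : in_l2 m delta.
Proof.
have := in_l2_minker hm hb Xk_incr y (lexx 0); congr in_l2.
by apply/funext => x; exact: minker0.
Qed.

Let S_l2 : in_l2 m S. Proof. exact: in_l2_minker. Qed.
Let W_l2 : in_l2 m W. Proof. exact: in_l2_minker_int. Qed.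

Let energy_form_u k (v : X -> R) : (forall x, x \notin Xk k -> v x = 0) ->
  energy_form b (u k) v = \sum_(x <- Xk k) m x * v x * (delta x - D k x).
Proof.
move=> vk; rewrite (green hm hb (@u_out k) vk) -sumrN.
apply: eq_big_seq => x xk.
by rewrite dker_int_laplacian // -mulrN opprB.
Qed.

(** This increasing bounded sequence telescopes the energies of the increments
of [u]; the sequence [d] does the same for their square norms in l2. *)
Let c k : R := \sum_(x <- Xk k) m x * u k x * (delta x + D k x).
Let d k : R := \sum_(x <- Xk k) m x * u k x ^+ 2.

Let grow (a : nat -> X -> R) : (forall k x, x \notin Xk k -> a k x = 0) ->
  (forall k j x, (k <= j)%N -> a k x <= a j x) ->
  {homo (fun k => \sum_(x <- Xk k) a k x) : k j / (k <= j)%N >-> k <= j}.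
Proof.
move=> a_out a_mono k j kj; rewrite -(sum_fset_supp (a_out k) (Xk_sub Xk_incr
  kj)).
by apply: ler_sum => x _; exact: a_mono.
Qed.

Let cauchy_of_bounded (a : nat -> R) (M : R) :
  {homo a : k j / (k <= j)%N >-> k <= j} -> (forall k, a k <= M) ->
  forall e, 0 < e -> \forall j \near \oo, forall k, (j <= k)%N -> a k - a j <=
    e.
Proof.
move=> a_mono aM e e0.
have cv : a k @[k --> \oo] --> limn a.
  by apply: nondecreasing_is_cvgn => //; exists M => _ [k _ <-].
have le_lim := nondecreasing_cvgn_le a_mono cv.
move/cvgrPdist_le : cv => /(_ _ e0); apply: filterS => j hj k jk.
have := le_lim k; have := ler_norm (limn a - a j); move: hj.
lra.
Qed.

Let c_cauchy e : 0 < e ->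
  \forall j \near \oo, forall k, (j <= k)%N -> c k - c j <= e.
Proof.
have [wB hwB] := (in_l2P hm W).1 W_l2.
have [sB hsB] := (in_l2P hm _).1 (in_l2D hm delta_l2 S_l2).
apply: (@cauchy_of_bounded c ((1 * wB + 1^-1 * sB) / 2)).
  apply: grow => [k x /u_out ->|k j x kj]; first by rewrite mulr0 mul0r.
  have /andP[u0 uu] := u_mono x kj; have /andP[D0 DD] := D_mono x kj.
  have dl0 : 0 <= delta x by rewrite /delta.
  by apply: ler_pM; rewrite ?mulr_ge0 ?addr_ge0 ?lerD2l// ler_wpM2l.
move=> k; apply: (le_trans _ (wdot_sum_le m0 hwB hsB ltr01 (Xk k))).
apply: ler_sum => x _; apply: (le_trans _ (ler_norm _)).
have u0 : 0 <= u k x by exact: dker_int_ge0.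
have D0 : 0 <= D k x by exact: dker_ge0.
have dl0 : 0 <= delta x by rewrite /delta.
apply: ler_pM; rewrite ?mulr_ge0 ?addr_ge0 ?lerD2l//.
  by rewrite ler_wpM2l//; exact: dker_int_le_minker_int.
exact: dker_le_minker.
Qed.

Let d_cauchy e : 0 < e ->
  \forall j \near \oo, forall k, (j <= k)%N -> d k - d j <= e.
Proof.
have [wB /sqsum_leP hwB] := (in_l2P hm W).1 W_l2.
apply: (@cauchy_of_bounded d wB).
  apply: grow => [k x /u_out ->|k j x kj]; first by rewrite expr0n mulr0.
  have /andP[u0 uu] := u_mono x kj.
  by rewrite ler_wpM2l// lerXn2r ?nnegrE// (le_trans u0).
move=> k; apply: le_trans (hwB (Xk k)); apply: ler_sum => x _.
have u0 : 0 <= u k x by exact: dker_int_ge0.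
have uW : u k x <= W x by exact: dker_int_le_minker_int.
by rewrite ler_wpM2l// lerXn2r ?nnegrE// (le_trans u0).
Qed.

Let energy_fin k : (sqsum ew (grad (u k)) < +oo)%E.
Proof. exact: finite_energy (@u_out k). Qed.

Let u_out_le k j x : (j <= k)%N -> x \notin Xk k -> u j x = 0.
Proof.
by move=> jk xk; apply: u_out; apply: contra xk;
  exact: (fsubsetP (Xk_sub Xk_incr jk)).
Qed.

Let gradB (f g : X -> R) :
  grad (fun x => f x - g x) = (fun e => grad f e - grad g e) :> (X * X -> R).
Proof. by apply/funext => e; rewrite /grad; ring. Qed.

(** Bilinearity and Green's formula turn the energy into sums over [Xk k]; in
the difference with the increment of [c], each term is nonnegative because [u]
and [D] increase. *)
Let energy_diff k j : (j <= k)%N ->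
  (sqsum ew (grad (fun x => u k x - u j x)%R) <= (2 * (c k - c j))%:E)%E.
Proof.
move=> jk; pose v x := u k x - u j x.
have v_out x : x \notin Xk k -> v x = 0.
  by move=> xk; rewrite /v (u_out_le jk xk) u_out// subrr.
have fin := finite_energy hb v_out.
have E : sqsum ew (grad v) = (2 * energy_form b v v)%:E.
  rewrite energy_formE mulVKf// /wdot rsum_ge0; last first.
    by move=> e; rewrite -mulrA mulr_ge0// -expr2 sqr_ge0.
  under [in RHS]eq_esum do rewrite -mulrA -expr2.
  by rewrite fineK// ge0_fin_numE// sqsum_ge0.
rewrite -/v E lee_fin ler_pM2l//.
have uj_out x : x \notin Xk k -> u j x = 0 by exact: u_out_le.
have Ev w : (sqsum ew (grad w) < +oo)%E ->
    energy_form b v w = energy_form b (u k) w - energy_form b (u j) w.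
  by move=> hw; rewrite !energy_formE -mulrBr -wdotBl// -gradB.
have Evr w : (sqsum ew (grad w) < +oo)%E ->
    energy_form b w v = energy_form b w (u k) - energy_form b w (u j).
  by move=> hw; rewrite !energy_formE -mulrBr -wdotBr// -gradB.
have sym f g : energy_form b f g = energy_form b g f.
  by rewrite !energy_formE wdotC.
rewrite Ev// !Evr// (sym (u j) (u k)) (energy_form_u (@u_out k)).
rewrite (energy_form_u uj_out) (energy_form_u (@u_out j)).
have -> : c j = \sum_(x <- Xk k) m x * u j x * (delta x + D j x).
  rewrite (sum_fset_supp _ (Xk_sub Xk_incr jk))// => x /u_out ->.
  by rewrite mulr0 mul0r.
have -> : \sum_(x <- Xk j) m x * u j x * (delta x - D j x) =
    \sum_(x <- Xk k) m x * u j x * (delta x - D j x).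
  rewrite (sum_fset_supp _ (Xk_sub Xk_incr jk))// => x /u_out ->.
  by rewrite mulr0 mul0r.
rewrite /c opprB -!sumrB; rewrite -big_split/=; apply: ler_sum => x _.
have /andP[u0 uu] := u_mono x jk; have /andP[D0 DD] := D_mono x jk.
rewrite -subr_ge0.
rewrite (_ : _ - _ = 2 * (m x * ((u k x - u j x) * D k x))); last by ring.
by rewrite !mulr_ge0// ?subr_ge0// (le_trans D0).
Qed.

Let sq_diff k j : (j <= k)%N ->
  (sqsum m (fun x => u k x - u j x)%R <= (d k - d j)%:E)%E.
Proof.
move=> jk; rewrite (@sqsum_finsupp _ _ _ hm (Xk k)); last first.
  by move=> x xk; rewrite (u_out_le jk xk) u_out// subrr.
have -> : d j = \sum_(x <- Xk k) m x * u j x ^+ 2.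
  rewrite (sum_fset_supp _ (Xk_sub Xk_incr jk))// => x /u_out ->.
  by rewrite expr0n mulr0.
rewrite lee_fin /d -sumrB; apply: ler_sum => x _.
have /andP[u0 uu] := u_mono x jk.
rewrite -subr_ge0 (_ : _ - _ = 2 * (m x * (u j x * (u k x - u j x))));
  last by ring.
by rewrite !mulr_ge0// subr_ge0.
Qed.

(** The increments from [j] to [k] are small uniformly in [k], and [k] tends to
infinity by Fatou's lemma. *)
Let approx e : 0 < e -> \forall j \near \oo,
  (sqsum ew (grad (fun x => W x - u j x)%R) <= e%:E)%E /\
  (sqsum m (fun x => W x - u j x)%R <= e%:E)%E.
Proof.
move=> e0; have e20 : 0 < e / 2 by rewrite divr_gt0.
have uW x : u k x @[k --> \oo] --> W x by exact: cvg_minker_int.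
near=> j.
have cj : forall k, (j <= k)%N -> c k - c j <= e / 2.
  by near: j; exact: c_cauchy.
have dj : forall k, (j <= k)%N -> d k - d j <= e.
  by near: j; exact: d_cauchy.
split.
  apply: (@sqsum_cvg _ _ _ (fun k => grad (fun x => u k x - u j x))).
    by move=> z; do 2!apply: cvgB => //; exact: cvg_cst.
  exists j => // k /= jk; rewrite (le_trans (energy_diff jk))// lee_fin.
  by have := cj k jk; lra.
apply: (@sqsum_cvg _ _ _ (fun k x => u k x - u j x)).
  by move=> x; apply: cvgB => //; exact: cvg_cst.
by exists j => // k /= jk; rewrite (le_trans (sq_diff jk))// lee_fin dj.
Unshelve. all: by end_near. Qed.

Let W_energy : (sqsum ew (grad W) < +oo)%E.
Proof.
have [j _ /(_ j (leqnn j))[h _]] := approx ltr01.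
have [a ha] := (sqsum_ltyP ew0 _).1 (energy_fin j).
have := sqsumD ew0 h ha.
rewrite (_ : (fun i => _) = grad W); last first.
  by apply/funext => e; rewrite /grad; ring.
by move/le_lt_trans; apply; rewrite ltry.
Qed.

Lemma form_norm_sq_le (f : X -> R) (a e : R) :
  (sqsum ew (grad f) <= a%:E)%E -> (sqsum m f <= e%:E)%E ->
  (form_norm_sq b m f <= (a / 2 + e)%:E)%E.
Proof.
move=> ha he; rewrite /form_norm_sq energyE l2norm_sqE EFinD leeD//.
rewrite mulrC EFinM.
apply: lee_wpmul2l => //.
Qed.

Lemma form_norm_sq_bounds (f : X -> R) (a : R) :
  (form_norm_sq b m f <= a%:E)%E ->
  (sqsum ew (grad f) <= (2 * a)%:E)%E /\ (sqsum m f <= a%:E)%E.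
Proof.
rewrite /form_norm_sq energyE l2norm_sqE => h.
have e0 := sqsum_ge0 ew0 (grad f); have n0 := sqsum_ge0 m0 f.
have E : (2^-1%:E * sqsum ew (grad f) <= a%:E)%E.
  by apply: le_trans h; rewrite leeDl.
split.
  have := lee_wpmul2l (x := 2%:E) _ E; rewrite lee_fin => /(_ (ler0n _ _)).
  by rewrite muleA -EFinM mulfV// mul1e EFinM.
by apply: le_trans h; rewrite leeDr// mule_ge0// lee_fin.
Qed.

Let W_domain : dirichlet_domain b m W.
Proof.
have [a ha] := (sqsum_ltyP ew0 _).1 W_energy;
  have [w hw] := (in_l2P hm W).1 W_l2.
split; first by rewrite (le_lt_trans (form_norm_sq_le ha hw))// ltry.
move=> e e0; have e2 : 0 < e ^+ 2 / 2 by rewrite divr_gt0// exprn_gt0.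
have [j _ /(_ j (leqnn j))[h1 h2]] := approx e2.
exists (u j); split.
  apply: (sub_finite_set _ (finite_fset (Xk j))) => x /=.
  by apply: contraNT => /u_out ->.
rewrite (le_lt_trans (form_norm_sq_le h1 h2))// lte_fin.
by clear h1 h2 ha hw; have : 0 < e ^+ 2; [exact: exprn_gt0|lra].
Qed.

Let rho_l2 : in_l2 m rho. Proof. exact: in_l2B. Qed.

Let W_form_finite (phi : X -> R) : finitely_supported phi ->
  energy_form b W phi = wdot m rho phi.
Proof.
move=> fphi; pose F := fset_set [set x | phi x != 0].
have phiF x : x \notin F -> phi x = 0.
  move=> xF; apply/eqP; apply: contraNT xF => px.
  by rewrite /F in_fset_set//; exact: mem_set.
have -> : wdot m rho phi = \sum_(x <- F) m x * phi x * rho x.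
  rewrite /wdot (rsum_finsupp (F := F)); first by apply: eq_bigr => x _; ring.
  by move=> x /phiF ->; rewrite mulr0.
have c1 : energy_form b (u j) phi @[j --> \oo] -->
    \sum_(x <- F) m x * phi x * rho x.
  have cv : \sum_(x <- F) m x * phi x * (delta x - D j x) @[j --> \oo] -->
      \sum_(x <- F) m x * phi x * rho x.
    apply: cvg_bigsum => x _; apply: cvgM; first exact: cvg_cst.
    by apply: cvgB; [exact: cvg_cst|exact: cvg_minker].
  apply: cvg_trans cv; apply: near_eq_cvg.
  apply: filterS (Xk_eventually Xk_incr Xk_cover F) => j Fj.
  rewrite energy_form_u; last first.
    by move=> x xj; apply: phiF; apply: contra xj; exact: (fsubsetP Fj).
  by apply/esym/sum_fset_supp => // x /phiF ->; rewrite mulr0 mul0r.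
suff c2 : energy_form b (u j) phi @[j --> \oo] --> energy_form b W phi.
  exact: (cvg_unique _ c2 c1).
have phifin := finite_energy hb phiF.
have [A hA] := (sqsum_ltyP ew0 _).1 phifin.
have A0 : 0 <= A by rewrite -lee_fin (le_trans _ hA)// sqsum_ge0.
(* A parameter for Young's inequality that makes the contribution of [A] at most
   [eta / 2]. *)
apply/cvgrPdist_le => eta eta0; pose e := (A + 1) / eta.
have e0 : 0 < e by rewrite divr_gt0// ltr_wpDl.
have ee : 0 < eta / e by rewrite divr_gt0.
apply: filterS (approx ee) => j [hj _].
have -> : energy_form b W phi - energy_form b (u j) phi =
    2^-1 * wdot ew (grad (fun x => W x - u j x)) (grad phi).
  by rewrite !energy_formE -mulrBr -wdotBl// -gradB.
rewrite normrM ger0_norm ?invr_ge0//.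
have := wdot_le ew0 hj hA e0; set q := `|_|.
rewrite mulrCA mulfV ?gt_eqF// mulr1.
have -> : e^-1 * A = eta * (A / (A + 1)).
  by rewrite /e; field; rewrite !gt_eqF// ltr_wpDl.
have : eta * (A / (A + 1)) <= eta * 1.
  by rewrite ler_wpM2l ?(ltW eta0)// ler_pdivrMr ?ltr_wpDl// mul1r lerDl.
by clear hj hA; lra.
Qed.

(** The weak equation for [W] against finitely supported functions is the limit
of those for [u k]; it extends to the form domain since both sides are
continuous for the form norm. *)
Lemma minker_int_laplacian : dirichlet_laplacian b m W rho.
Proof.
split=> // v [vfin vapprox]; rewrite l2innerE.
have [a ha] := (sqsum_ltyP ew0 _).1 W_energy;
  have [r hr] := (in_l2P hm rho).1 rho_l2.
have a0 : 0 <= a by rewrite -lee_fin (le_trans _ ha)// sqsum_ge0.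
have r0 : 0 <= r by rewrite -lee_fin (le_trans _ hr)// sqsum_ge0.
have [nv hnv] : exists c, (form_norm_sq b m v <= c%:E)%E.
  exists (fine (form_norm_sq b m v)); rewrite fineK// ge0_fin_numE//.
  by rewrite /form_norm_sq energyE l2norm_sqE adde_ge0 ?mule_ge0 ?sqsum_ge0
    ?lee_fin.
have [vE vN] := form_norm_sq_bounds hnv.
have bound eta : 0 < eta -> `|energy_form b W v - wdot m rho v| <= eta * (a + r
  + 2).
  move=> eta0; have [phi [fphi hphi]] := vapprox eta eta0.
  have [dE dN] := form_norm_sq_bounds (ltW hphi).
  have phiE : (sqsum ew (grad phi) < +oo)%E.
    have := sqsumB ew0 vE dE; rewrite (_ : (fun i => _) = grad phi).
      by move/le_lt_trans; apply; rewrite ltry.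
    by apply/funext => e; rewrite /grad -![(v - phi) _]/(v _ - phi _); ring.
  have phiN : (sqsum m phi < +oo)%E.
    have := sqsumB m0 vN dN; rewrite (_ : (fun i => _) = phi).
      by move/le_lt_trans; apply; rewrite ltry.
    by apply/funext => e; rewrite -![(v - phi) _]/(v _ - phi _); ring.
  have lt (Y : choiceType) w (f : Y -> R) q : (sqsum w f <= q%:E)%E -> (sqsum w
    f < +oo)%E.
    by move/le_lt_trans; apply; rewrite ltry.
  have -> : energy_form b W v - wdot m rho v =
      2^-1 * wdot ew (grad W) (grad (v - phi)) - wdot m rho (v - phi).
    have -> : wdot ew (grad W) (grad (v - phi)) =
        wdot ew (grad W) (grad v) - wdot ew (grad W) (grad phi).
      by rewrite -wdotBr// ?(lt _ _ _ _ ha) ?(lt _ _ _ _ vE)// -gradB.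
    have -> : wdot m rho (v - phi) = wdot m rho v - wdot m rho phi.
      by rewrite -wdotBr// ?(lt _ _ _ _ hr) ?(lt _ _ _ _ vN).
    rewrite -(W_form_finite fphi) !energy_formE; ring.
  have h1 := wdot_le ew0 ha dE eta0; have h2 := wdot_le m0 hr dN eta0.
  rewrite (le_trans (ler_normB _ _))// normrM (ger0_norm (_ : 0 <= 2^-1))
    ?invr_ge0//.
  move: h1 h2; rewrite (_ : eta^-1 * (2 * eta ^+ 2) = 2 * eta); last first.
    by field; rewrite gt_eqF.
  rewrite (_ : eta^-1 * eta ^+ 2 = eta); last by field; rewrite gt_eqF.
  have := mulr_ge0 (ltW eta0) a0; have := mulr_ge0 (ltW eta0) r0.
  clear ha hr hnv vE vN dE dN hphi.
  by move: `|wdot ew _ _| `|wdot m _ _| => p q; lra.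
apply/eqP; rewrite -subr_eq0 -normr_eq0 eq_le normr_ge0 andbT.
apply/ler_addgt0Pl => e e0; rewrite addr0.
have K0 : 0 < a + r + 2 by rewrite ltr_wpDl ?addr_ge0.
by have := bound _ (divr_gt0 e0 K0); rewrite divfK// gt_eqF.
Qed.

End IntegratedKernelDomain.

(** * The Dirichlet semigroup has the minimal heat kernel *)

Section Identification.
Context (R : realType) (X : countType) (m : X -> R) (b : X -> X -> R).
Hypothesis hm : forall x, 0 < m x.
Hypothesis hb : is_graph b.
Variable Xk : nat -> {fset X}.
Hypothesis Xk_incr : forall k, (Xk k `<=` Xk k.+1)%fset.
Hypothesis Xk_cover : forall x, exists k, x \in Xk k.
Variable P : R -> (X -> R) -> (X -> R).
Hypothesis hP : is_exp_semigroup m (dirichlet_laplacian b m) P.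

Let m0 x : 0 <= m x. Proof. exact: ltW. Qed.
Local Notation S := (minker m b Xk).
Local Notation W := (minker_int m b Xk).

Let C0 : C0_semigroup m P. Proof. by case: hP. Qed.

Let W_generator s y : 0 <= s ->
  minus_generator m P (fun x => W s x y) (fun x => (x == y)%:R - S s x y).
Proof.
move=> s0; apply: generator_minus => //.
exact/(hP.2)/minker_int_laplacian.
Qed.

Let P_increment h t y : 0 < h -> 0 <= t ->
  P t (fun x => W h x y) = (fun x => W (t + h) x y - W t x y).
Proof.
move=> h0 t0.
have := @C0_unique _ _ _ hm P C0 (fun s x => W (s + h) x y - W s x y)
  (fun s x => ((x == y)%:R - S (s + h) x y) - ((x == y)%:R - S s x y)) t t0.
have -> : (fun x => W (0 + h) x y - W 0 x y) = fun x => W h x y.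
  by apply/funext => x; rewrite add0r minker_int0 subr0.
move=> -> // s /andP[s0 st].
  by apply: minus_generatorB => //; apply: W_generator; rewrite ?addr_ge0// ltW.
(* By [sqsumB], the remainders of the two difference quotients add up to at most
   [K * |r - s|^3]. *)
move=> e e0; pose K := 16 * deg b y.
have K0 : 0 <= K by rewrite mulr_ge0 ?deg_ge0.
have K1 : 0 < K + 1 by rewrite ltr_wpDl.
exists (e / (K + 1)); first by rewrite divr_gt0.
move=> r /andP[r0 rt] rs.
have sh : 0 <= s + h by rewrite addr_ge0// ltW.
have rh : 0 <= r + h by rewrite addr_ge0// ltW.
have := sqsumB m0 (minker_int_sqlip hm hb Xk_incr y sh rh)
                  (minker_int_sqlip hm hb Xk_incr y s0 r0).
have -> : r + h - (s + h) = r - s by ring.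
rewrite (_ : (fun i => _ - _) = fun x => W (r + h) x y - W r x y -
   (W (s + h) x y - W s x y) +
   (r - s) * ((x == y)%:R - S (s + h) x y - ((x == y)%:R - S s x y)));
     last first.
  by apply/funext => x; ring.
move/le_trans; apply; rewrite lee_fin.
have -> : `|r - s| ^+ 3 = (r - s) ^+ 2 * `|r - s|.
  by rewrite -(real_normK (num_real (r - s))) -exprSr.
have -> : 2 * (4 * deg b y * ((r - s) ^+ 2 * `|r - s|) +
    4 * deg b y * ((r - s) ^+ 2 * `|r - s|)) = K * `|r - s| * (r - s) ^+ 2.
  by rewrite /K; ring.
rewrite ler_wpM2r ?sqr_ge0// (@le_trans _ _ (K * (e / (K + 1))))//.
  by rewrite ler_wpM2l// ltW.
by rewrite mulrCA ler_piMr ?(ltW e0)// ler_pdivrMr// mul1r lerDl.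
Qed.

(** The quotients [W_h / h] and [(W_{t+h} - W_t) / h] are within [O(sqrt h)] of
the indicator of [y] and of [S_t(.,y)], and [P t] is bounded and maps the first
to the second. *)
Lemma exp_semigroup_delta t y : 0 <= t ->
  P t (fun x => (x == y)%:R) = (fun x => S t x y).
Proof.
move=> t0; apply: (l2_eq hm) => e e0.
have bP := C0_bounded C0 t0; have [C C_ge0 hC] := op_bounded hm bP.
pose K := 2 * (C + 1) * (4 * deg b y).
have dy0 := deg_ge0 hb y.
have K0 : 0 <= K by rewrite !mulr_ge0 ?addr_ge0.
have K1 : 0 < K + 1 by rewrite ltr_wpDl.
(* The total error below is at most [K * h]. *)
pose h := e / (K + 1); have h0 : 0 < h by rewrite divr_gt0.
have rescale (s : R) : 0 <= s -> (sqsum m (fun x =>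
    h^-1 * (W (s + h) x y - W s x y) - S s x y)%R <= (4 * deg b y * h)%:E)%E.
  move=> s0; have sh : 0 <= s + h by rewrite addr_ge0// ltW.
  have := sqsumZ h^-1 (minker_int_sqlip hm hb Xk_incr y s0 sh).
  rewrite addrAC subrr add0r gtr0_norm//.
  rewrite (_ : (fun i => _) = fun x =>
      h^-1 * (W (s + h) x y - W s x y) - S s x y); last first.
    by apply/funext => x; field; rewrite gt_eqF.
  move/le_trans; apply; rewrite lee_fin le_eqVlt; apply/orP; left; apply/eqP.
  by field; rewrite gt_eqF.
have dl2 : in_l2 m (fun x : X => (x == y)%:R).
  have := in_l2_minker hm hb Xk_incr y (lexx 0); congr in_l2.
  by apply/funext => x; exact: minker0.
have Wl2 : in_l2 m (fun x => h^-1 * W h x y).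
  by apply: in_l2Z => //; apply: in_l2_minker_int => //; exact: ltW.
have first := rescale 0 (lexx 0).
have := sqsumB m0 (rescale t t0) (hC _ _ first).
have -> : (fun x => h^-1 * (W (0 + h) x y - W 0 x y) - S 0 x y) =
    fun x => h^-1 * W h x y - (x == y)%:R.
  by apply/funext => x; rewrite add0r minker_int0 subr0 minker0.
rewrite (opB bP Wl2 dl2) (opZ hm bP); last first.
  by apply: in_l2_minker_int => //; exact: ltW.
rewrite P_increment//.
rewrite (_ : (fun i => _ - _ - (_ - _)) = fun x => P t (fun z => (z == y)%:R) x
  - S t x y); last first.
  by apply/funext => x /=; ring.
move/le_trans; apply; rewrite lee_fin.
have -> : 2 * (4 * deg b y * h + C * (4 * deg b y * h)) = e * (K / (K + 1)).
  by rewrite /h /K; field; rewrite gt_eqF.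
by rewrite ler_piMr ?(ltW e0)// ler_pdivrMr// mul1r lerDl.
Qed.

End Identification.

(** * The Neumann semigroups *)

Section NeumannSemigroup.
Context (R : realType) (X : countType) (m : X -> R) (b : X -> X -> R).
Implicit Types (F : {fset X}) (t : R).

Lemma neumann_laplacian_gen F (g : F -> R) (x : F) (v : X -> R) :
  (forall z : F, g z = v (val z)) ->
  neumann_laplacian b m g x = - kop F (neumann_gen m b F) v (val x).
Proof.
move=> gv; rewrite /neumann_laplacian /kop.
have -> : \sum_(y : F) b (val x) (val y) * (g x - g y) =
    \sum_(y <- F) b (val x) y * (v (val x) - v y).
  by rewrite big_seq_fsetE/=; apply: eq_bigr => y _; rewrite !gv.
have -> : \sum_(y <- F) b (val x) y * (v (val x) - v y) =
    \sum_(y <- F) (b (val x) y * v (val x) -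
     b (val x) y * v y) by apply: eq_bigr => y _; rewrite mulrBr.
rewrite sumrB -mulr_suml.
have -> : \sum_(y <- F) neumann_gen m b F (val x) y * v y =
    (m (val x))^-1 * (\sum_(y <- F) b (val x) y * v y -
      (\sum_(z <- F) b (val x) z) * v (val x)).
  rewrite -(sum_delta (fun y => (\sum_(z <- F) b (val x) z) * v y) (valP x)).
  rewrite -sumrB mulr_sumr; apply: eq_bigr => y _.
  by rewrite /neumann_gen eq_sym; ring.
ring.
Qed.

(** On the finite set, the iterates of [- t] times the Neumann Laplacian are
given by the powers of [neumann_gen]. *)
Lemma neumann_semigroupE F t f x :
  neumann_semigroup b m F t f x = \sum_(y <- F) nker m b F t x y * f y.
Proof.
rewrite /neumann_semigroup /extend_by_0; case: insubP => [x' xF xE|xF];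
  last first.
  by rewrite big1// => y _; rewrite nker_outl// mul0r.
pose a := neumann_gen m b F.
pose w n z := \sum_(y <- F) f y * kpow F a n z y.
have itE n (z : F) : iter n (fun g => - t *: neumann_laplacian b m g)
    (fun z : F => f (val z)) z = t ^+ n * w n (val z).
  elim: n z => [|n IH] z.
    rewrite /= expr0 mul1r /w -(sum_delta f (valP z)).
    by apply: eq_bigr => y _; rewrite /kpow /= eq_sym.
  rewrite iterS -[LHS]/(- t * neumann_laplacian b m _ z).
  rewrite (@neumann_laplacian_gen _ _ _ (fun z => t ^+ n * w n z) IH).
  rewrite mulrNN exprS -mulrA; congr (_ * _).
  rewrite /kop /w mulr_sumr; under eq_bigr do rewrite mulrCA mulr_sumr
    mulr_sumr.
  rewrite exchange_big/=; apply: eq_bigr => y _.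
  by rewrite kpowS !mulr_sumr; apply: eq_bigr => v _; rewrite /a; ring.
have -> : \sum_(y <- F) nker m b F t x y * f y = egf (fun n => w n x) t.
  rewrite /w egf_sum; last by move=> y; exact: geo_bounded_kpow.
  by apply: eq_bigr => y _; rewrite /nker -xE (valP x') mulrC.
rewrite /exp_operator /egf /pseries; congr (limn (series _)); apply/funext => n.
by rewrite itE xE mulrC [t ^+ n * _]mulrC mulrAC.
Qed.

End NeumannSemigroup.

(** * Conservation of mass *)

Section StochasticCompleteness.
Context (R : realType) (X : countType) (m : X -> R) (b : X -> X -> R).
Hypothesis hm : forall x, 0 < m x.
Hypothesis hb : is_graph b.
Variable Xk : nat -> {fset X}.
Hypothesis Xk_incr : forall k, (Xk k `<=` Xk k.+1)%fset.
Hypothesis Xk_cover : forall x, exists k, x \in Xk k.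
Implicit Types (F : {fset X}) (x y z : X) (s t : R).

Let m0 x : 0 <= m x. Proof. exact: ltW. Qed.
Local Notation S := (minker m b Xk).
Local Notation D k := (dker m b (Xk k)).
Local Notation Nk k := (nker m b (Xk k)).

Definition conservative t : Prop :=
  forall x, \esum_(y in [set: X]) (S t x y)%:E = 1%:E.

Let D0 k t x y : 0 <= t -> 0 <= D k t x y. Proof. exact: dker_ge0. Qed.
Let S0 t x y : 0 <= t -> 0 <= S t x y.
Proof. exact: minker_ge0. Qed.

Let sum_minker_le t x F : 0 <= t -> \sum_(y <- F) S t x y <= 1.
Proof. by move=> t0; apply/(esum_leP _ _).1/minker_row. Qed.

Lemma minker_row_decr s t x : 0 <= s -> 0 <= t ->
  (\esum_(y in [set: X]) (S (s + t) x y)%:E <=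
   \esum_(y in [set: X]) (S s x y)%:E)%E.
Proof.
move=> s0 t0; have st : 0 <= s + t by rewrite addr_ge0.
have S0s y : 0 <= S s x y by exact: S0.
rewrite [leRHS](esum_fin (minker_row hm hb Xk_incr x s0) S0s).
apply/esum_leP => F.
apply: (@cvg_le _ (fun k => \sum_(y <- F) D k (s + t) x y)).
  by apply: cvg_bigsum => y _; exact: cvg_minker.
apply: nearW => k; rewrite -lee_fin -(esum_fin (minker_row hm hb Xk_incr x s0)
  S0s).
apply: le_trans (sum_le_esum _ (Xk k)); rewrite lee_fin.
under eq_bigr do rewrite dkerD.
rewrite exchange_big/=; apply: ler_sum => z _; rewrite -mulr_sumr.
rewrite (@le_trans _ _ (D k s x z * 1))//; last first.
  by rewrite mulr1; exact: dker_le_minker.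
by rewrite ler_wpM2l ?D0// dker_row.
Qed.

Let minker_CK_le s t x y F : 0 <= s -> 0 <= t ->
  \sum_(z <- F) S s x z * S t z y <= S (s + t) x y.
Proof.
move=> s0 t0; have st : 0 <= s + t by rewrite addr_ge0.
apply: (@cvg_le _ (fun k => \sum_(z <- F) D k s x z * D k t z y)).
  by apply: cvg_bigsum => z _; apply: cvgM; exact: cvg_minker.
apply: nearW => k; apply: le_trans (dker_le_minker hm hb Xk_incr k x y st).
rewrite dkerD -(sum_fset_supp _ (fsubsetUl (Xk k) F)); last first.
  by move=> z zk; rewrite dker_outr// mul0r.
by apply: sum_fset_le (fsubsetUr _ F) => z; rewrite mulr_ge0 ?D0.
Qed.

(** By Fubini, the total mass after time [s + t] is at least the mass after time
[s] of the function [1], which the kernel at time [t] reproduces. *)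
Lemma conservativeD s t : 0 <= s -> 0 <= t ->
  conservative s -> conservative t -> conservative (s + t).
Proof.
move=> s0 t0 cs ct x; have st : 0 <= s + t by rewrite addr_ge0.
apply/eqP; rewrite eq_le minker_row//=.
have Sst y : 0 <= S (s + t) x y by exact: S0.
rewrite -(cs x) [leRHS](esum_fin (minker_row hm hb Xk_incr x st) Sst).
apply/esum_leP => F.
rewrite -lee_fin -(esum_fin (minker_row hm hb Xk_incr x st) Sst).
rewrite (@le_trans _ _ (\esum_(y in [set: X]) \sum_(z <- F) (S s x z * S t z
  y)%:E)%E)//.
  rewrite esum_sum; last by move=> y z _ _; rewrite lee_fin mulr_ge0 ?S0.
  rewrite -sumEFin; apply: lee_sum => z _; rewrite esumZl ?S0//; last first.
    by move=> y; exact: S0.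
  by rewrite ct mule1.
by apply: le_esum => y _; rewrite sumEFin lee_fin minker_CK_le.
Qed.

(** Conservation propagates to the multiples of [s] by the semigroup law, and
then down to all times since row sums decrease with time. *)
Lemma conservative_all s t :
  0 < s -> conservative s -> 0 <= t -> conservative t.
Proof.
move=> s0 cs t0.
have cn n : conservative (n.+1%:R * s).
  elim: n => [|n IH]; first by rewrite mul1r.
  rewrite -natr1 mulrDl mul1r; apply: conservativeD => //; last exact: ltW.
  by rewrite mulr_ge0// ltW.
have [n hn] : exists n : nat, t <= n.+1%:R * s.
  exists (Num.truncn (t / s)); rewrite -ler_pdivrMr//;
    exact: ltW (truncnS_gt _).
move=> x; apply/eqP; rewrite eq_le minker_row//= -(cn n x).
have -> : n.+1%:R * s = t + (n.+1%:R * s - t) by ring.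
by apply: minker_row_decr => //; rewrite subr_ge0.
Qed.

Definition row k t y : R := \sum_(x <- Xk k) D k t y x.

Let row_le1 k t y : 0 <= t -> row k t y <= 1.
Proof. by move=> t0; exact: dker_row. Qed.

(** Monotone convergence of the row sums of [D^k] to those of the minimal
kernel. *)
Lemma cvg_row t y : 0 <= t -> conservative t ->
  row k t y @[k --> \oo] --> (1 : R).
Proof.
move=> t0 ct; apply/cvgrPdist_le => e e0.
have e20 : 0 < e / 2 by rewrite divr_gt0.
have [F hF] : exists F, 1 - e / 2 < \sum_(x <- F) S t y x.
  apply: contrapT => /forallNP hF.
  have : (1%:E <= (1 - e / 2)%:E)%E.
    by rewrite -(ct y); apply/esum_leP => F; rewrite leNgt; apply/negP;
      exact: hF.
  by rewrite lee_fin lerBrDr gerDl leNgt e20.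
have cF : \sum_(x <- F) D k t y x @[k --> \oo] --> \sum_(x <- F) S t y x.
  by apply: cvg_bigsum => x _; exact: cvg_minker.
move/cvgrPdist_le : cF => /(_ _ e20) cF.
near=> k.
have Fk : (F `<=` Xk k)%fset by near: k; exact: Xk_eventually.
have hk : `|\sum_(x <- F) S t y x - \sum_(x <- F) D k t y x| <= e / 2.
  by near: k; exact: cF.
rewrite ger0_norm ?subr_ge0 ?row_le1//.
have : \sum_(x <- F) D k t y x <= row k t y.
  by apply: sum_fset_le Fk => x; exact: D0.
move: hk hF; rewrite ler_norml => /andP[_];
  move: (row _ _ _) (\sum_(x <- F) S t y x).
by move: (\sum_(x <- F) D k t y x) => u v w; lra.
Unshelve. all: by end_near. Qed.

(** Both [Nk k] and [S] lie above [D k]. Column [y] of [Nk k] has mass at most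
[m y] and so has column [y] of [S], whereas that of [D k] has mass [m y * row k
t y]. *)
Let sum_abs_diff k t y F : 0 <= t ->
  \sum_(x <- F) m x * `|Nk k t x y - S t x y| <= 2 * m y * (1 - row k t y).
Proof.
move=> t0.
have DN x : D k t x y <= Nk k t x y by exact: dker_le_nker.
have DS x : D k t x y <= S t x y by exact: dker_le_minker.
have h1 : \sum_(x <- F) m x * (Nk k t x y - D k t x y) <= m y * (1 - row k t y).
  apply: (@le_trans _ _ (\sum_(x <- Xk k) m x * (Nk k t x y - D k t x y))).
    rewrite -(sum_fset_supp _ (fsubsetUl (Xk k) F)); last first.
      by move=> x xk; rewrite nker_outl// dker_outl// subrr mulr0.
    apply: sum_fset_le (fsubsetUr _ F) => x.
    by rewrite mulr_ge0// subr_ge0.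
  have [yk|yk] := boolP (y \in Xk k); last first.
    rewrite big1; first by rewrite mulr_ge0// subr_ge0 row_le1.
    by move=> x _; rewrite nker_outr// dker_outr// subrr mulr0.
  rewrite -(nker_row1 m b t yk) /row -sumrB mulr_sumr; apply: ler_sum => x _.
  rewrite !mulrBr (nker_sym hm hb (Xk k) t x y) (dker_sym hm hb (Xk k) t x y).
  exact: lexx.
have h2 : \sum_(x <- F) m x * (S t x y - D k t x y) <= m y * (1 - row k t y).
  apply: (@le_trans _ _ (m y * \sum_(x <- (Xk k `|` F)%fset) (S t y x - D k t y
    x))).
    rewrite mulr_sumr; apply: (@le_trans _ _ (\sum_(x <- F) m y * (S t y x - D
      k t y x))).
      apply: ler_sum => x _.
      rewrite !mulrBr (minker_sym hm hb Xk_incr x y t0).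
      by rewrite (dker_sym hm hb (Xk k) t x y) lexx.
    apply: sum_fset_le (fsubsetUr _ F) => x.
    by rewrite mulr_ge0// subr_ge0; exact: dker_le_minker.
  rewrite ler_wpM2l// sumrB lerB ?sum_minker_le//.
  rewrite (sum_fset_supp _ (fsubsetUl (Xk k) F))// => x xk.
  by rewrite dker_outr.
have : \sum_(x <- F) m x * `|Nk k t x y - S t x y| <=
    \sum_(x <- F) m x * (Nk k t x y - D k t x y) +
    \sum_(x <- F) m x * (S t x y - D k t x y).
  rewrite -big_split/=; apply: ler_sum => x _; rewrite -mulrDr ler_wpM2l//.
  have := DN x; have := DS x; rewrite ler_norml => ? ?.
  by apply/andP; split; lra.
move: h1 h2; move: (\sum_(x <- F) m x * `|_|) (\sum_(x <- F) m x * _) => p q.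
move: (\sum_(x <- F) m x * _) (row k t y) => r w; nra.
Qed.

Lemma conservative_strong_l1 t (f : X -> R) : 0 <= t -> conservative t ->
  in_l1 m f -> forall e, 0 < e -> \forall k \near \oo,
  (l1norm m (fun x => neumann_semigroup b m (Xk k) t f x -
                      rsum (fun y => S t x y * f y))%R <= e%:E)%E.
Proof.
move=> t0 ct fl1 e e0.
have fsum : absum (fun y => `|f y| * m y).
  apply/absumP; rewrite (eq_esum (b := fun y => (`|f y| * m y)%:E))//.
  by move=> y _; rewrite ger0_norm// mulr_ge0.
pose g k y := `|f y| * (2 * m y * (1 - row k t y)).
have r0 k y : 0 <= row k t y by apply: sumr_ge0 => x _; exact: D0.
have hg : forall e, 0 < e -> \forall k \near \oo,
    (\esum_(y in [set: X]) (g k y)%:E <= e%:E)%E.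
  apply: (tannery (absumZ 2 fsum)) => [k y|k y|y].
  - by rewrite mulr_ge0// mulr_ge0 ?subr_ge0 ?row_le1// mulr_ge0.
  - rewrite /g (_ : 2 * (_ * _) = `|f y| * (2 * m y * 1)); last by ring.
    by rewrite ler_wpM2l// ler_wpM2l ?mulr_ge0// gerBl.
  - have -> : 0 = `|f y| * (2 * m y * (1 - 1)) by rewrite subrr !mulr0.
    apply: cvgM; first exact: cvg_cst.
    apply: cvgM; first exact: cvg_cst.
    by apply: cvgB; [exact: cvg_cst|exact: cvg_row].
apply: filterS (hg e e0) => k hk; apply/esum_leP => F.
have Sf x : absum (fun y => S t x y * f y).
  apply: (absum_le (absumZ (m x)^-1 fsum)) => y.
  rewrite normrM (ger0_norm (S0 _ _ t0)) mulrC mulrCA ler_wpM2l//.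
  rewrite mulrC ler_pdivlMr// mulrC (minker_sym hm hb Xk_incr x y t0).
  rewrite ler_piMr//; have := sum_minker_le y [fset x]%fset t0.
  by rewrite big_seq_fset1.
have N_out x y : y \notin Xk k -> Nk k t x y * f y = 0.
  by move=> yk; rewrite nker_outr// mul0r.
pose a x y := `|Nk k t x y - S t x y| * `|f y|.
have a_ge0 x y : 0 <= a x y by rewrite mulr_ge0.
have [v hv] : exists v : X -> R, forall x,
    \esum_(y in [set: X]) (a x y)%:E = (v x)%:E.
  exists (fun x => fine (\esum_(y in [set: X]) (a x y)%:E)) => x.
  have [c hc] := absumB (absum_finsupp (N_out x)) (Sf x).
  apply: (@esum_fin _ _ _ c) => //; apply/esum_leP => G; apply: le_trans (hc G).
  by apply: ler_sum => y _; rewrite -mulrBl normrM.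
have le_v x : `|neumann_semigroup b m (Xk k) t f x -
    rsum (fun y => S t x y * f y)| <= v x.
  rewrite neumann_semigroupE -(rsum_finsupp (N_out x)) -rsumB//; last first.
    exact: absum_finsupp (N_out x).
  apply: rsum_le; apply/esum_leP; rewrite -hv; apply: le_esum => y _.
  by rewrite -mulrBl normrM.
apply: (@le_trans _ _ (\sum_(x <- F) m x * v x)).
  by apply: ler_sum => x _; rewrite mulrC ler_wpM2l.
rewrite -lee_fin; apply: le_trans hk; rewrite -sumEFin.
under eq_bigr do rewrite EFinM -hv -esumZl//.
rewrite -esum_sum; last by move=> y x _ _; rewrite lee_fin mulr_ge0.
apply: le_esum => y _; rewrite sumEFin lee_fin /g.
apply: le_trans (ler_wpM2l (normr_ge0 (f y)) (sum_abs_diff k y F t0)).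
by rewrite mulr_sumr; apply: ler_sum => x _; rewrite /a mulrA mulrC.
Qed.

(** The approximating functions have mass [m y] once [y] lies in [X_k], because
the Neumann kernels are symmetric with row sums 1. *)
Lemma strong_l1_mass t (K : X -> X -> R) y : (forall x, 0 <= K x y) ->
  (forall e, 0 < e -> \forall k \near \oo,
    (l1norm m (fun x =>
       neumann_semigroup b m (Xk k) t (fun z => (z == y)%:R) x - K x y)%R
     <= e%:E)%E) ->
  ((m y)%:E <= \esum_(x in [set: X]) (m x * K x y)%:E)%E.
Proof.
move=> K0 h; apply/lee_addgt0Pr => e e0.
have near_y := Xk_eventually Xk_incr Xk_cover [fset y]%fset.
have [k [+ hk]] : exists k, (([fset y] `<=` Xk k)%fset /\
   (l1norm m (fun x =>
      neumann_semigroup b m (Xk k) t (fun z => (z == y)%:R) x - K x y)%R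
    <= e%:E)%E).
  have [k _ hk] := filterI near_y (h e e0); exists k; exact: hk (leqnn k).
rewrite fsub1set => yk.
have NE x : neumann_semigroup b m (Xk k) t (fun z => (z == y)%:R) x = Nk k t x
  y.
  by rewrite neumann_semigroupE sum_delta.
have := (esum_leP _ _).1 hk (Xk k).
have -> : m y = \sum_(x <- Xk k) m x * Nk k t x y.
  rewrite -[LHS]mulr1 -(nker_row1 m b t yk) mulr_sumr.
  by apply: eq_bigr => x _; rewrite (nker_sym hm hb (Xk k) t y x).
move=> hsum; apply: (@le_trans _ _ ((\sum_(x <- Xk k) m x * K x y) + e)%:E).
  rewrite lee_fin -lerBlDl; apply: le_trans hsum; rewrite -sumrB.
  apply: ler_sum => x _; rewrite NE -mulrBr mulrC ler_wpM2r//.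
  exact: ler_norm.
by rewrite EFinD leeD2r// sum_le_esum.
Qed.

End StochasticCompleteness.

(** * The equivalence *)

Section DirichletSemigroup.
Context (R : realType) (X : countType) (m : X -> R) (b : X -> X -> R).
Hypothesis hm : forall x, 0 < m x.
Hypothesis hb : is_graph b.
Variable Xk : nat -> {fset X}.
Hypothesis Xk_incr : forall k, (Xk k `<=` Xk k.+1)%fset.
Hypothesis Xk_cover : forall x, exists k, x \in Xk k.

Let m0 x : 0 <= m x. Proof. exact: ltW. Qed.
Let semigroups :=
  [set P | is_exp_semigroup m (dirichlet_laplacian b m) P].

Lemma dirichlet_semigroup_minker P t f :
  is_exp_semigroup m (dirichlet_laplacian b m) P -> 0 <= t ->
  dirichlet_semigroup b m t f =
    (fun x => rsum (fun y => minker m b Xk t x y * f y)).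
Proof.
move=> hP t0.
have h : is_exp_semigroup m (dirichlet_laplacian b m) (dirichlet_semigroup_l2 b
  m).
  by apply: (xgetPex _ (P := semigroups)); exists P.
apply/funext => x; apply: eq_rsum => y.
rewrite /heat_kernel (exp_semigroup_delta hm hb Xk_incr Xk_cover h y t0).
by field; rewrite gt_eqF.
Qed.

(** Without a semigroup generated by [- L^(D)], the choice defining the
Dirichlet semigroup returns its default value. *)
Lemma dirichlet_semigroup_none t f :
  (forall P, ~ is_exp_semigroup m (dirichlet_laplacian b m) P) ->
  dirichlet_semigroup b m t f = (fun x => 0).
Proof.
move=> no; have h0 : dirichlet_semigroup_l2 b m = fun _ _ => 0.
  by apply: (xgetPN _ (P := semigroups)) => P hP; exact: no hP.
apply/funext => x; rewrite /dirichlet_semigroup (@rsum_finsupp _ _ _ fset0).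
  by rewrite big_seq_fset0.
by move=> y _; rewrite /heat_kernel h0 [_ x]/(0 : R) mul0r !mul0r.
Qed.

Lemma stochastically_completeP P t :
  is_exp_semigroup m (dirichlet_laplacian b m) P -> 0 < t ->
    stochastically_complete b m <-> conservative m b Xk t.
Proof.
move=> hP t0.
have sem s : 0 <= s -> dirichlet_semigroup b m s (fun _ => 1) = (fun _ => 1) <->
    conservative m b Xk s.
  move=> s0; rewrite (dirichlet_semigroup_minker _ hP s0).
  have S0 x y : 0 <= minker m b Xk s x y by exact: minker_ge0.
  have E x : (rsum (fun y => minker m b Xk s x y * 1))%:E =
      \esum_(y in [set: X]) (minker m b Xk s x y)%:E.
    rewrite (esum_fin (minker_row hm hb Xk_incr x s0) (S0 x)) rsum_ge0.
      by congr (fine _)%:E; apply: eq_esum => y _; rewrite mulr1.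
    by move=> y; rewrite mulr1.
  split=> [h x|h]; first by rewrite -E; congr (_%:E); exact: (congr1 (@^~ x) h).
  by apply/funext => x; have := h x; rewrite -E => -[].
split=> [[s s0 /(sem s (ltW s0)) cs]|ct].
  exact: conservative_all cs (ltW t0).
by exists t => //; apply/sem => //; exact: ltW.
Qed.

End DirichletSemigroup.

Lemma strong_l1_cvgP (R : realType) (X : countType) (m : X -> R)
    (hm : forall x, 0 < m x) (T_ : nat -> (X -> R) -> (X -> R))
    (T : (X -> R) -> (X -> R)) :
  strong_l1_cvg m T_ T <->
  forall f, in_l1 m f -> forall e, 0 < e ->
    \forall k \near \oo, (l1norm m (fun x => T_ k f x - T f x)%R <= e%:E)%E.
Proof.
split=> h f fl1.
  by move=> e e0; exact: (cvge0_near_le (h f fl1) e0).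
apply: near_le_cvge0; last exact: h.
by move=> k; apply: esum_ge0 => x _; rewrite lee_fin mulr_ge0// ltW.
Qed.

Lemma in_l1_delta (R : realType) (X : countType) (m : X -> R) (y : X)
    (hm : forall x, 0 < m x) : in_l1 m (fun x => (x == y)%:R).
Proof.
rewrite /in_l1 /l1norm (esum_finsupp (F := [fset y]%fset)) ?ltry//.
  by move=> x; rewrite mulr_ge0// ltW.
by move=> x; rewrite inE => /negPf ->; rewrite normr0 mul0r.
Qed.

(** In the first case the Dirichlet semigroup has the minimal kernel; in the
second case it is 0, which never preserves the mass [m y > 0] of the indicator
of a vertex [y]. *)
Theorem theorem4p1 (R : realType) (X : countType)
    (m : X -> R) (hm : forall x, 0 < m x)
    (b : X -> X -> R) (hb : is_graph b) (hconn : graph_connected b)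
    (Xk : nat -> {fset X}) (hXk : exhaustion b Xk)
    (t : R) (ht : 0 < t) :
  stochastically_complete b m <->
  strong_l1_cvg m (fun k => neumann_semigroup b m (Xk k) t)
                  (dirichlet_semigroup b m t).
Proof.
have [Xk_incr Xk_cover _] := hXk.
have t0 := ltW ht; rewrite (strong_l1_cvgP hm).
have [[P hP]|no] := pselect (exists P, is_exp_semigroup m (dirichlet_laplacian
  b m) P).
  rewrite (stochastically_completeP hm hb Xk_incr Xk_cover hP ht).
  split=> [ct f fl1 e e0|h y].
    rewrite (dirichlet_semigroup_minker hm hb Xk_incr Xk_cover _ hP t0).
    exact: conservative_strong_l1.
  have S0 x z : 0 <= minker m b Xk t x z by exact: minker_ge0.
  have S1 := minker_row hm hb Xk_incr y t0.
  apply/eqP; rewrite eq_le S1/=.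
  have : ((m y)%:E <= \esum_(x in [set: X]) (m x * minker m b Xk t x y)%:E)%E.
    apply: (strong_l1_mass hm hb Xk_incr Xk_cover) => // e e0.
    have E : dirichlet_semigroup b m t (fun x => (x == y)%:R) =
        (fun x => minker m b Xk t x y).
      rewrite (dirichlet_semigroup_minker hm hb Xk_incr Xk_cover _ hP t0).
      apply/funext => x; rewrite (@rsum_finsupp _ _ _ [fset y]%fset).
        by rewrite big_seq_fset1 eqxx mulr1.
      by move=> z; rewrite inE => /negPf ->; rewrite mulr0.
    by have hk := h _ (in_l1_delta y hm) e e0; rewrite E in hk; exact: hk.
  rewrite (eq_esum (b := fun x => (m y * minker m b Xk t y x)%:E)); last first.
    by move=> x _; rewrite (minker_sym hm hb Xk_incr x y t0).
  rewrite esumZl ?(ltW (hm y))// (esum_fin S1 (S0 y)) -EFinM !lee_fin.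
  by rewrite -[leLHS]mulr1 ler_pM2l.
have {}no P : ~ is_exp_semigroup m (dirichlet_laplacian b m) P.
  by move=> hP; apply: no; exists P.
split=> [[s _]|h].
  rewrite (dirichlet_semigroup_none s _ no) => h01 f _ e e0; apply: nearW => k.
  rewrite /l1norm esum1 ?lee_fin ?ltW// => x _.
  have : 0 = 1 :> R := congr1 (@^~ x) h01.
  by move/eqP; rewrite eq_sym oner_eq0.
exists 1 => //; apply/funext => y.
have : ((m y)%:E <= \esum_(x in [set: X]) (m x * 0)%:E)%E.
  apply: (strong_l1_mass (K := fun _ _ => 0) hm hb Xk_incr Xk_cover) => // e e0.
  have hk := h _ (in_l1_delta y hm) e e0.
  by rewrite (dirichlet_semigroup_none t _ no) in hk; exact: hk.
by rewrite esum1 => [|x _]; rewrite ?mulr0// lee_fin leNgt hm.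
Qed.
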